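(* Assume the Hardy-Littlewood Conjecture. Let $\alpha$ be a fixed integer with $\alpha\equiv 1\pmod 4$ and let $D=l$ be an odd prime. Then: If $l\equiv 1\pmod 8$, then $\mathrm{dens}_l(2\alpha)=\frac{l-5}{4(l-2)}$ and $\mathrm{dens}_l(-2\alpha)=\frac{l-1}{4(l-2)}$. If $l\equiv 5\pmod 8$, then $\mathrm{dens}_l(2\alpha)=\frac{l-1}{4(l-2)}$ and $\mathrm{dens}_l(-2\alpha)=\frac{l-5}{4(l-2)}$. If $l\equiv 3\pmod 4$, then $\mathrm{dens}_l(2\alpha)=\mathrm{dens}_l(-2\alpha)=\frac{l-1}{4l}$.
   Context: For a nonzero integer $D$, $E_D$ is the elliptic curve $y^2=x^3+Dx$, and for a prime $p\nmid 2D$, $a_p(E_D)=1+p-\#\tilde E_D(\mathbb{F}_p)$. For a nonzero integer $r$ put $Q(r,N)=\{p \text{ prime}: p=r^2+x^2\le N \text{ for some } x\in\mathbb{Z}\}$ and $$\mathrm{dens}_D(2r)=\lim_{N\to\infty}\frac{\#\{p\in Q(r,N): p\nmid 2D,\ a_p(E_D)=2r\}}{\#Q(r,N)}$$ (denoted $a_p(E_D,2r)$ or $a_p(2r)$ in the paper); the claim includes that the limits exist. Hardy-Littlewood Conjecture: for all integers $a,b,c$ with $a>0$, $\gcd(a,b,c)=1$, $a+b$ and $c$ not both even, and $\Delta=b^2-4ac$ not a perfect square, the number $P(n)$ of primes less than $n$ of the form $ax^2+bx+c$ (with $x$ a nonnegative integer) satisfies $P(n)\sim\delta(a,b,c)\frac{\sqrt{n}}{\log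 n}$ as $n\to\infty$, where $$\delta(a,b,c)=\frac{\gcd(2,a+b)}{\sqrt{a}}\prod_{p\mid a,\ p\mid b,\ p>2}\frac{p}{p-1}\ \prod_{p\nmid a,\ p>2}\left(1-\frac{\left(\frac{\Delta}{p}\right)}{p-1}\right),$$ the products being over primes (the second taken in increasing order of $p$) and $\left(\frac{\cdot}{p}\right)$ being the Legendre symbol.
   Formalization: The formal theorem additionally assumes that l does not divide α; when l divides α the stated densities are wrong under the Hardy-Littlewood Conjecture (for l = α = 5 they are 0 and 1 instead of 1/3 and 0). *)

(* Defs.v *)
From HB Require Import structures.
From mathcomp Require Import all_boot all_order all_algebra.
From mathcomp Require Import all_classical all_reals all_analysis.
Set Implicit Arguments.
Unset Strict Implicit.
Unset Printing Implicit Defensive.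
Import Order.TTheory GRing.Theory Num.Theory.
Import numFieldNormedType.Exports.
Local Open Scope classical_set_scope.
Local Open Scope ring_scope.

(* Points of the reduction mod p of y^2 = x^3 + D x, with [None] the point at
   infinity. Only meaningful for p prime, p not dividing 2D. *)
Definition ED_points (D : int) (p : nat) : {pred option ('F_p * 'F_p)} :=
  fun P => if P is Some (x, y) then y ^+ 2 == x ^+ 3 + D%:~R * x else true.

Arguments ED_points : clear implicits.

Definition ap (D : int) (p : nat) : int := 1 + p%:Z - #|ED_points D p|%:Z.

Definition Q (r : int) (N : nat) : seq nat :=
  [seq p <- iota 0 N.+1 |
    prime p && `[< exists x : int, p%:Z = r ^+ 2 + x ^+ 2 >]].

Definition dens_seq (R : realType) (D r : int) (N : nat) : R :=
  (count (fun p : nat => ~~ (p%:Z %| 2 * D)%Z && (ap D p == 2 * r)) (Q r N))%:R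
  / (size (Q r N))%:R.

(* dens_D(2r) exists and equals v. *)
Definition has_dens (R : realType) (D r : int) (v : R) : Prop :=
  dens_seq R D r @ \oo --> v.

(* Legendre symbol (a/p), for p an odd prime. *)
Definition legendre (a : int) (p : nat) : int :=
  if (p%:Z %| a)%Z then 0
  else if [exists x : 'F_p, x ^+ 2 == a%:~R] then 1 else -1.

Definition disc (a b c : int) : int := b ^+ 2 - 4 * a * c.

Definition prime_values (a b c : int) (n : nat) : nat :=
  count (fun p => prime p &&
           `[< exists x : nat, p%:Z = a * x%:Z ^+ 2 + b * x%:Z + c >])
        (iota 0 n).

Definition HL_partial_product (R : realType) (a b c : int) (n : nat) : R :=
  \prod_(0 <= p < n | [&& prime p, (2 < p)%N & ~~ (p%:Z %| a)%Z])
     (1 - (legendre (disc a b c) p)%:~R / (p%:R - 1)).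

(* The infinite product converges only conditionally, hence the limit of
   partial products in increasing order of p. *)
Definition HL_delta (R : realType) (a b c : int) : R :=
  (gcdz 2 (a + b))%:~R / Num.sqrt a%:~R
  * (\prod_(p <- primes `|a|%N | (p%:Z %| b)%Z && (2 < p)%N)
       (p%:R / (p%:R - 1)))
  * limn (HL_partial_product R a b c).

Definition HardyLittlewood (R : realType) : Prop :=
  forall a b c : int,
    0 < a ->
    gcdz a (gcdz b c) = 1 ->
    ~~ ((2 %| a + b)%Z && (2 %| c)%Z) ->
    ~ (exists k : int, disc a b c = k ^+ 2) ->
    (fun n : nat => (prime_values a b c n)%:R : R) ~_(\oo)
    (fun n : nat => HL_delta R a b c * (Num.sqrt n%:R / ln n%:R)).

(* Main.v *)
Require Import Defs.
From HB Require Import structures.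
From mathcomp Require Import all_boot all_order all_algebra.
From mathcomp Require Import all_fingroup all_solvable all_field.
From mathcomp Require Import all_classical all_reals all_analysis.
From mathcomp Require Import zify ring lra.
Import Order.TTheory GRing.Theory Num.Theory.
Import numFieldNormedType.Exports.
Set Implicit Arguments.
Unset Strict Implicit.
Unset Printing Implicit Defensive.
Local Open Scope ring_scope.

(** Let p = alpha^2 + x^2 be a prime not dividing 2l, where alpha = 1 mod 4; then
    x is even and p = 1 mod 4. The proof turns the event a_p(E_l) = 2 alpha or
    -2 alpha into a condition on x modulo 4l, counts the residue classes that
    satisfy it, and uses the Hardy-Littlewood conjecture to see that all
    admissible classes receive asymptotically the same number of primes.

    Reading off a_p. One has a_p(E_D) = - S(D) with the Jacobsthal sum S(D), the
    sum over t of rho(t^3 + D t), rho being the quadratic character. Substituting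
    t -> u t gives S(D u^2) = rho(u) S(D), so up to sign S takes two values on
    nonzero D: S(1), and S(g) for a primitive element g. The second moment of S
    shows S(1)^2 + S(g)^2 = 4p, and the symmetries t -> -t, 1/t of the curve
    y^2 = t^3 + t give S(1) = -2 mod 8. As p is a sum of two squares in only one
    way, S(1) = -2 alpha and S(g) = 2x or -2x (jacobsthal_two_squares). Hence
    a_p(E_D) = 2 alpha iff D is a fourth power mod p, and a_p(E_D) = -2 alpha iff
    D is a square but not a fourth power (ap_eq_twice).

    Quartic reciprocity. Whether l is a fourth power mod p is decided in an
    algebraically closed field of characteristic l containing i with i^2 = -1.
    Let G be the Gauss sum of the quartic character chi of F_p. Its Jacobi sum
    with rho is, up to sign, z = alpha + i x or its conjugate z' (this is where
    the values S(1) and S(g) enter again), whence G^4 = z^3 z' or z'^3 z.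
    Comparing this with G^l, which the Frobenius map computes as a value of the
    character at 1/l times a Gauss sum, yields chi(l) = (z'/z)^k up to inversion
    when l = 4k + 1, and the same with an extra factor (-1)^((p-1)/4) when
    l = 4k - 1 (quartic_reciprocity_1mod4 and quartic_reciprocity_3mod4).

    Counting. As x runs over the residues mod l with alpha^2 + x^2 != 0, the
    quotient z'/z runs over the 4k-th roots of unity other than -1. Each of the
    four values of (z'/z)^k is therefore taken k times, except that the value
    (-1)^k is taken only k - 1 times (card_quartic_residues). The missing root
    -1 is what makes the densities differ from 1/4.

    Equidistribution. For a residue class r mod 4l, the primes alpha^2 + x^2
    with x >= 0 and x = r are the prime values of one quadratic polynomial with
    discriminant - (8 l alpha)^2, and the constant delta is the same for all
    admissible r (HL_delta_class). For the resulting asymptotic formulas to say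
    anything, delta must not vanish. That is Mertens' theorem for the character
    mod 4: the sums of chi4(p) log p / p over p <= N stay bounded, by Chebyshev's
    upper bound and L(1, chi4) > 0, so the product defining delta converges to a
    nonzero limit by partial summation (euler_product_cvg, HL_delta_neq0). The
    density is then the proportion of good classes among the admissible ones
    (ratio_cvg). *)

(** * Multiplicative characters of a finite field *)
Section MultiplicativeCharacters.

Variables (F : finFieldType) (g : F).
Hypothesis g_prim : (#|F|.-1).-primitive_root g.

Definition dlog (x : F) : nat :=
  if [pick i : 'I_#|F|.-1 | x == g ^+ i] is Some i then i else 0%N.

(** The character sending the primitive element g to w. Keeping w in an arbitrary
    ring lets the same quadratic character be used with values in the integers,
    for point counts, and in a field of characteristic l, for Gauss sums. It is
    multiplicative when w is a root of unity of order dividing the order of g. *)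
Definition mchar (R : nzRingType) (w : R) (x : F) : R :=
  if x == 0 then 0 else w ^+ dlog x.

Lemma prim_neq0 : g != 0.
Proof.
apply/eqP=> g0; have /eqP := prim_expr_order g_prim.
have /prednK <- := prim_order_gt0 g_prim.
by rewrite g0 exprS mul0r eq_sym oner_eq0.
Qed.

Lemma dlogK x : x != 0 -> g ^+ dlog x = x.
Proof.
move=> x0; rewrite /dlog; case: pickP => [i /eqP-> // | nog].
have x1 : x ^+ #|F|.-1 = 1.
  apply: (mulfI x0); rewrite -exprS mulr1 prednK ?expf_card //.
  by apply/card_gt0P; exists 0.
have [i xi] := prim_rootP g_prim x1.
by have := nog i; rewrite xi eqxx.
Qed.

Lemma prim_powP x : x != 0 -> exists k, x = g ^+ k.
Proof. by move=> x0; exists (dlog x); rewrite dlogK. Qed.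

Section Values.

Variable R : comNzRingType.
Implicit Types w : R.

Lemma mchar0 w : mchar w 0 = 0.
Proof. by rewrite /mchar eqxx. Qed.

Lemma mcharX w k : w ^+ #|F|.-1 = 1 -> mchar w (g ^+ k) = w ^+ k.
Proof.
move=> w1; rewrite /mchar expf_eq0 (negPf prim_neq0) andbF.
have gk : g ^+ k != 0 by rewrite expf_eq0 (negPf prim_neq0) andbF.
have /eqP := dlogK gk; rewrite (eq_prim_root_expr g_prim) => /eqP e.
by rewrite -[LHS](expr_mod _ w1) e expr_mod.
Qed.

Lemma mchar_one w : w ^+ #|F|.-1 = 1 -> mchar w 1 = 1.
Proof. by move=> w1; rewrite -(expr0 g) mcharX // expr0. Qed.

Lemma mcharM w x y :
  w ^+ #|F|.-1 = 1 -> mchar w (x * y) = mchar w x * mchar w y.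
Proof.
move=> w1; have [->|x0] := eqVneq x 0; first by rewrite mul0r mchar0 mul0r.
have [->|y0] := eqVneq y 0; first by rewrite mulr0 mchar0 mulr0.
have [[i ->] [j ->]] := (prim_powP x0, prim_powP y0).
by rewrite -exprD !mcharX // exprD.
Qed.

Lemma mchar_mul w w' x : mchar w x * mchar w' x = mchar (w * w') x.
Proof. by rewrite /mchar; case: eqP => _; rewrite ?mul0r // exprMn. Qed.

Lemma mchar_exp w n x : mchar w x ^+ n.+1 = mchar (w ^+ n.+1) x.
Proof.
by rewrite /mchar; case: eqP => _; rewrite ?expr0n // -!exprM mulnC.
Qed.

Lemma mchar_triv x : mchar (1 : R) x = (x != 0)%:R.
Proof. by rewrite /mchar; case: eqP => _; rewrite ?expr1n. Qed.

Lemma mcharV w x : w ^+ #|F|.-1 = 1 -> mchar w x * mchar w x^-1 = (x != 0)%:R.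
Proof.
move=> w1; have [->|x0] := eqVneq x 0; first by rewrite mchar0 mul0r.
by rewrite -mcharM // divff // mchar_one.
Qed.

End Values.

(** Multiplying the variable by g multiplies the sum by w, which is not 1. *)
Lemma sum_mchar (R : idomainType) (w : R) :
  w ^+ #|F|.-1 = 1 -> w != 1 -> \sum_x mchar w x = 0.
Proof.
move=> w1 wn1; apply: (@mulfI _ (1 - w)); first by rewrite subr_eq0 eq_sym.
rewrite mulr0 mulrBl mul1r.
suff -> : w * \sum_x mchar w x = \sum_x mchar w x by rewrite subrr.
rewrite [RHS](reindex_inj (mulfI prim_neq0)) /= mulr_sumr.
have wg : mchar w g = w by rewrite -[RHS]expr1 -mcharX.
by apply: eq_bigr => x _; rewrite mcharM // wg.
Qed.

End MultiplicativeCharacters.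

Lemma exists_primitive_element (F : finFieldType) :
  {g : F | (#|F|.-1).-primitive_root g}.
Proof.
have q1 : (0 < #|F|.-1)%N by rewrite -subn1 subn_gt0 finNzRing_gt1.
have := @has_prim_root F #|F|.-1 (enum [set~ (0 : F)]) q1 _ (enum_uniq _) _.
set b := has _ _ => hb; have : b.
  apply: hb; last by rewrite -cardE cardsC1.
  apply/allP=> x; rewrite mem_enum !inE => x0; apply/unity_rootP.
  apply: (mulfI x0); rewrite -exprS mulr1 prednK ?expf_card //.
  exact: ltnW (finNzRing_gt1 F).
by move/hasP/sig2W=> [g _ ?]; exists g.
Qed.

(** * Jacobsthal sums over a field with 4m+1 elements *)
Section JacobsthalSums.

Variables (F : finFieldType) (g : F) (m : nat).
Hypothesis g_prim : (#|F|.-1).-primitive_root g.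
Hypothesis cardF : #|F| = (4 * m).+1.

Let q1E : #|F|.-1 = (4 * m)%N. Proof. by rewrite cardF. Qed.

Let m_gt0 : (0 < m)%N.
Proof. by have := finNzRing_gt1 F; rewrite cardF; case: m. Qed.

Let rho : F -> int := mchar g (-1 : int).

Lemma sign_char_order (R : pzRingType) : (-1 : R) ^+ #|F|.-1 = 1.
Proof. by rewrite q1E exprM -signr_odd expr1n. Qed.

Let s1 := sign_char_order int.

Lemma neg1_prim : -1 = g ^+ (2 * m) :> F.
Proof.
have : (g ^+ (2 * m)) ^+ 2 == 1.
  by rewrite -exprM mulnAC -q1E (prim_expr_order g_prim).
rewrite sqrf_eq1 => /orP[|/eqP//].
rewrite -(prim_order_dvd g_prim) q1E => /dvdn_leq; lia.
Qed.

Lemma quad_charM x y : rho (x * y) = rho x * rho y.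
Proof. exact: mcharM. Qed.

Lemma quad_char0 : rho 0 = 0. Proof. exact: mchar0. Qed.

Lemma quad_char1 : rho 1 = 1. Proof. exact: mchar_one. Qed.

Lemma quad_char_sqr x : rho x * rho x = (x != 0)%:R.
Proof. by rewrite /rho mchar_mul mulrNN mulr1 mchar_triv. Qed.

Lemma quad_char_neq0 x : x != 0 -> rho x = 1 \/ rho x = -1.
Proof.
move=> x0; have := quad_char_sqr x; rewrite x0 -expr2 => /eqP.
by rewrite sqrf_eq1 => /orP[] /eqP; [left|right].
Qed.

Lemma quad_char_neg1 : rho (-1) = 1.
Proof. by rewrite neg1_prim /rho mcharX // exprM -signr_odd expr1n. Qed.

Lemma quad_charN x : rho (- x) = rho x.
Proof. by rewrite -mulN1r quad_charM quad_char_neg1 mul1r. Qed.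

Lemma sum_quad_char : \sum_x rho x = 0.
Proof. exact: sum_mchar. Qed.

Lemma two_neq0 : 2 != 0 :> F.
Proof.
apply/eqP=> two0; have : g ^+ (2 * m) == 1.
  by rewrite -neg1_prim eq_sym -subr_eq0 opprK -[1 + 1]/(2%:R) two0.
rewrite -(prim_order_dvd g_prim) q1E => /dvdn_leq; lia.
Qed.

Lemma card_square_roots u : #|[set x : F | x ^+ 2 == u]|%:Z = 1 + rho u.
Proof.
have [->|u0] := eqVneq u 0.
  rewrite quad_char0 addr0 (_ : [set _ | _] = [set 0]) ?cards1 //.
  by apply/setP=> x; rewrite !inE sqrf_eq0.
have [k uE] := prim_powP g_prim u0.
have rk : rho u = (-1) ^+ k by rewrite uE /rho mcharX.
have [ek|ok] := boolP (odd k); last first.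
  have kE : k = (2 * k./2)%N by lia.
  rewrite (_ : [set _ | _] = [set g ^+ k./2; - g ^+ k./2]).
    rewrite cards2 rk -signr_odd (negPf ok).
    have /negPf-> // : g ^+ k./2 != - g ^+ k./2.
    rewrite -subr_eq0 opprK -mulr2n -mulr_natl mulf_neq0 ?two_neq0 //.
    by rewrite expf_neq0 // (prim_neq0 g_prim).
  by apply/setP=> x; rewrite !inE uE kE mulnC exprM eqf_sqr -mulnC -kE.
rewrite (_ : [set _ | _] = finset.set0).
  by rewrite cards0 rk -[k]odd_double_half ek exprD -mul2n exprM sqrrN !expr1n.
apply/setP=> x; rewrite !inE; apply/negP=> /eqP xu.
have x0 : x != 0 by apply: contraNneq u0 => x0; rewrite -xu x0 expr0n.
have : rho u = 1 by rewrite -xu quad_charM quad_char_sqr x0.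
by rewrite rk -signr_odd ek.
Qed.

(** For a != b, translate D so that the summand is rho (D (D + c)) with c = b - a.
    Dividing by D^2 turns it into rho (1 + c / D), and for D != 0 the argument
    runs over all values other than 1. *)
Lemma sum_quad_char_shift a b :
  \sum_D rho ((D + a) * (D + b)) = #|F|%:R * (a == b)%:R - 1.
Proof.
rewrite (reindex_inj (addIr (- a))) /=.
under eq_bigr => D _ do rewrite subrK -addrA [- a + b]addrC.
have [->|neq_ab] := eqVneq a b.
  under eq_bigr => D _ do rewrite subrr addr0 quad_charM quad_char_sqr.
  by rewrite (bigD1 0) //= eqxx add0r (eq_bigr (fun=> 1)) => [|x ->//];
     rewrite sumr_const cardC1 cardF mulr1 -natr1 addrK.
set c := b - a; have c0 : c != 0 by rewrite subr_eq0 eq_sym.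
rewrite mulr0 add0r (bigD1 0) //= mul0r quad_char0 add0r.
pose h (v : F) := c * (v - 1)^-1.
have := sum_quad_char; rewrite (bigD1 1) //= quad_char1 => /eqP.
rewrite addrC addr_eq0 => /eqP <-.
rewrite [RHS](reindex_onto (fun D => 1 + c / D) h) /=; last first.
  move=> v v1; rewrite /h invfM invrK mulrA divff // mul1r.
  by rewrite addrC subrK.
apply: eq_big => [D|D D0].
  have [->|D0] := eqVneq D 0; first by rewrite invr0 mulr0 addr0 eqxx.
  rewrite /h addrAC subrr add0r invfM invrK mulrA divff // mul1r eqxx andbT.
  by rewrite -subr_eq0 addrAC subrr add0r mulf_eq0 (negPf c0) invr_eq0 (negPf D0).
have -> : 1 + c / D = D^-1 ^+ 2 * (D * (D + c)) by field.
by rewrite [RHS]quad_charM expr2 [rho (D^-1 * _)]quad_charM quad_char_sqr invr_eq0 D0 mul1r.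
Qed.

Definition jacobsthal (D : F) : int := \sum_x rho (x ^+ 3 + D * x).

Lemma jacobsthal_twist D t :
  t != 0 -> jacobsthal (D * t ^+ 2) = rho t * jacobsthal D.
Proof.
move=> t0; rewrite /jacobsthal (reindex_inj (mulfI t0)) mulr_sumr.
apply: eq_bigr => x _.
have -> : (t * x) ^+ 3 + D * t ^+ 2 * (t * x) = t * (t * t) * (x ^+ 3 + D * x).
  by ring.
by rewrite !quad_charM -[rho t * (_ * _)]mulr1 quad_char_sqr t0 !mulr1.
Qed.

Lemma jacobsthal0 : jacobsthal 0 = 0.
Proof.
rewrite -[RHS]sum_quad_char; apply: eq_bigr => x _.
rewrite mul0r addr0 exprS expr2 !quad_charM quad_char_sqr.
by case: eqP => [->|_]; rewrite ?quad_char0 ?mul0r ?mulr1.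
Qed.

(** Expand the square as a double sum over x and y; the inner sum over D is q - 1
    when x^2 = y^2 and -1 otherwise, so only y = x and y = -x survive, and they
    contribute equally because rho (-1) = 1. *)
Lemma jacobsthal_second_moment :
  \sum_D jacobsthal D ^+ 2 = 2 * #|F|%:R * (#|F|%:R - 1).
Proof.
have E D : jacobsthal D ^+ 2 =
    \sum_x \sum_y rho (x * y) * rho ((D + x ^+ 2) * (D + y ^+ 2)).
  rewrite expr2 /jacobsthal mulr_suml; apply: eq_bigr => x _.
  rewrite mulr_sumr; apply: eq_bigr => y _; rewrite -!quad_charM.
  by congr rho; ring.
under eq_bigr => D _ do rewrite E.
rewrite exchange_big /=; under eq_bigr => x _.
  rewrite exchange_big /=; under eq_bigr => y _.
    rewrite -mulr_sumr sum_quad_char_shift mulrBr mulr1 quad_charM.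
    rewrite eqf_sqr.
    over.
  rewrite sumrB -mulr_sumr sum_quad_char mulr0 subr0.
  over.
rewrite (bigD1 0) //= big1 ?add0r => [|y _]; last by rewrite quad_char0 !mul0r.
have T x : x != 0 -> \sum_y rho x * rho y *
     (#|F|%:R * ((x == y) || (x == - y))%:R) = 2 * #|F|%:R :> int.
  move=> x0; rewrite (bigD1 x) //= (bigD1 (- x)) /=; last first.
    rewrite -subr_eq0 -opprD oppr_eq0 -mulr2n -mulr_natl.
    by rewrite mulf_neq0 ?two_neq0.
  rewrite big1 => [|y /andP[yx yNx]]; last first.
    by rewrite eq_sym (negPf yx) -eqr_oppLR eq_sym (negPf yNx) !mulr0.
  rewrite opprK !eqxx orbT quad_charN quad_char_sqr x0 addr0.
  by rewrite !mulr1 !mul1r -mulr2n mulr_natl.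
rewrite (eq_bigr _ T) sumr_const cardC1 -mulr_natr cardF /=.
by rewrite -[(4 * m).+1%:R]natr1 addrK [RHS]mulr_natr.
Qed.

(** By the twisting rule, jacobsthal D ^+ 2 depends only on whether D is a square,
    so the second moment is (q - 1) / 2 times the sum of the two values. *)
Lemma jacobsthal_sum_squares :
  jacobsthal 1 ^+ 2 + jacobsthal g ^+ 2 = 4 * #|F|%:R.
Proof.
set a := jacobsthal 1; set b := jacobsthal g.
have E D : 2 * jacobsthal D ^+ 2 =
   (D != 0)%:R * (a ^+ 2 + b ^+ 2) + rho D * (a ^+ 2 - b ^+ 2).
  have [->|D0] := eqVneq D 0; first by rewrite jacobsthal0 quad_char0 !mul0r.

  have [k DE] := prim_powP g_prim D0.
  have rk : rho D = (-1) ^+ k by rewrite DE /rho mcharX.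
  have gk0 j : g ^+ j != 0 by rewrite expf_neq0 ?(prim_neq0 g_prim).
  have kE : k = (odd k + k./2 * 2)%N by lia.
  have -> : jacobsthal D ^+ 2 = if odd k then b ^+ 2 else a ^+ 2.
    rewrite DE [in LHS]kE exprD exprM jacobsthal_twist // exprMn expr2.
    rewrite quad_char_sqr gk0 mul1r.
    by case: (odd k).
  rewrite rk -signr_odd mul1r; case: (odd k) => /=; rewrite ?expr1 ?expr0; ring.
have := congr1 (fun z => 2 * z) jacobsthal_second_moment.
rewrite /= mulr_sumr; under eq_bigr => D _ do rewrite E.
rewrite big_split /= -!mulr_suml sum_quad_char mul0r addr0.
rewrite (bigD1 0) //= eqxx add0r (eq_bigr (fun=> 1)) => [|x ->//].
rewrite sumr_const cardC1 cardF /= => e.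
have m0 : ((4 * m)%:R : int) != 0 by rewrite pnatr_eq0; lia.
by apply: (mulfI m0); rewrite e -[(4 * m).+1%:R]natr1; ring.
Qed.

Let quarter := g ^+ m.

Lemma sqr_prim_quarter : quarter ^+ 2 = -1.
Proof. by rewrite neg1_prim /quarter -exprM mulnC. Qed.

Let neg1_neq1 : -1 != 1 :> F.
Proof. by rewrite -subr_eq0 -opprD oppr_eq0; apply: two_neq0. Qed.

(** With i^2 = -1 one has 2 = - i (1 + i)^2, so 2 is a square iff i is. *)
Lemma quad_char2 : rho 2 = (-1) ^+ m.
Proof.
have i1 : 1 + quarter != 0.
  apply/eqP=> /eqP; rewrite addrC addr_eq0 => /eqP e.
  have := sqr_prim_quarter; rewrite e sqrrN expr1n => /esym/eqP.
  by rewrite (negPf neg1_neq1).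
have -> : 2 = - (quarter * ((1 + quarter) * (1 + quarter))).
  have -> : quarter * ((1 + quarter) * (1 + quarter)) =
    quarter + 2 * quarter ^+ 2 + quarter * quarter ^+ 2 by ring.
  by rewrite sqr_prim_quarter; ring.
by rewrite quad_charN quad_charM [rho (_ * _)]quad_charM quad_char_sqr i1 mulr1
           /rho mcharX.
Qed.

Let A := [set x : F | [&& x != 0, x ^+ 2 != 1 & x ^+ 2 != -1]].

Let B := [set x in A | rho (x ^+ 3 + x) == 1].

(** The value of rho (x^3 + x) is unchanged under x -> -x and x -> 1/x. These
    maps act freely on A, whose orbits have four elements and are the fibres of
    x^2 + x^-2. *)
Lemma card_plus_orbits : (4 %| #|B|)%N.
Proof.
pose f (x : F) := x ^+ 2 + x^-1 ^+ 2.
(* Each nonempty fibre of f on B is an orbit {x, -x, 1/x, -1/x}. *)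
rewrite -sum1_card (partition_big f predT) //=.
apply: dvdn_sum => v _; rewrite sum1dep_card.
have [->|[x]] := set_0Vmem [set x | (x \in B) && (f x == v)].
  by rewrite cards0.
rewrite !inE => /andP[/andP[/and3P[x0 x1 xN1] xr] /eqP fx].
suff -> : [set y | (y \in B) && (f y == v)] = [set y in [:: x; - x; x^-1; - x^-1]].
  have U : uniq [:: x; - x; x^-1; - x^-1].
    have H (y : F) : y != 0 -> y != - y.
      move=> y0; rewrite -subr_eq0 opprK -mulr2n -mulr_natl.
      by rewrite mulf_neq0 ?two_neq0.
    have H1 : x != x^-1.
      by apply: contraNneq x1 => e; rewrite expr2 {2}e divff.
    have H2 : x != - x^-1.
      by apply: contraNneq xN1 => e; rewrite expr2 {2}e mulrN divff.
    rewrite /= !inE !negb_or H // H1 H2 H ?invr_eq0 //=.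
    by rewrite eqr_oppLR H2 eqr_opp H1.
  by rewrite cardsE (card_uniqP U).
apply/setP=> y; rewrite !inE; apply/idP/idP.
  move=> /andP[/andP[/and3P[y0 y1 yN1] yr]]; rewrite -fx => /eqP e.
  have : ((y - x) * (y + x)) * ((y - x^-1) * (y + x^-1)) == 0.
    have : y ^+ 2 * (f y - f x) = 0 by rewrite e subrr mulr0.
    move=> <-; apply/eqP; rewrite /f; field; by rewrite x0 y0.
  by rewrite !mulf_eq0 !subr_eq0 !addr_eq0 -!orbA.
have V (z : F) : z != 0 -> rho (z^-1 ^+ 3 + z^-1) = rho (z ^+ 3 + z).
  move=> z0; have -> : z^-1 ^+ 3 + z^-1 =
    (z^-1 * z^-1) * ((z^-1 * z^-1) * (z ^+ 3 + z)) by field.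
  rewrite quad_charM [rho (_ * (_ + _))]quad_charM quad_charM.
  by rewrite quad_char_sqr invr_eq0 z0 !mul1r.
have N (z : F) : rho ((- z) ^+ 3 + - z) = rho (z ^+ 3 + z).
  by rewrite -quad_charN; congr rho; ring.
have x1' : x^-1 ^+ 2 != 1 by rewrite exprVn -invr1 (inj_eq invr_inj).
have xN1' : x^-1 ^+ 2 != -1.
  by rewrite exprVn -[-1]invrK invrN invr1 (inj_eq invr_inj).
rewrite -fx /f; case/or4P=> /eqP ->;
by rewrite ?N ?V ?sqrrN ?oppr_eq0 ?invr_eq0 ?invrN ?sqrrN ?invrK
           ?x0 ?x1 ?xN1 ?x1' ?xN1' ?xr //= addrC.
Qed.

(** The points 0, 1, -1 and the two square roots of -1 contribute 2 rho(2), and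
    the remaining q - 5 points contribute 2 #|B| - (q - 5) with 4 | #|B|. *)
Lemma jacobsthal1_mod8 : exists k : int, jacobsthal 1 = 8 * k - 2.
Proof.
have i2 := sqr_prim_quarter.
have i0 : quarter != 0 by rewrite expf_neq0 // (prim_neq0 g_prim).
pose s := [:: 0; 1; -1; quarter; - quarter].
have U : uniq s.
  rewrite /= !inE !negb_or ![0 == _]eq_sym !oppr_eq0 i0 oner_eq0 /=.
  have iN1 : quarter != 1.
    by apply: contraNneq neg1_neq1 => e; rewrite -i2 e expr1n.
  have iN2 : quarter != - 1.
    by apply: contraNneq neg1_neq1 => e; rewrite -i2 e sqrrN expr1n.
  have H3 : 1 != - quarter by rewrite -eqr_oppLR eq_sym.
  have H6 : quarter != - quarter.
    rewrite -subr_eq0 opprK -mulr2n -mulr_natl.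
    by rewrite mulf_neq0 ?two_neq0.
  rewrite ![_ == quarter]eq_sym H3 H6 iN1 iN2 eqr_opp [1 == quarter]eq_sym iN1.
  by rewrite eq_sym neg1_neq1.
have As x : (x \in s) = (x \notin A).
  rewrite !inE !negb_and !negbK; congr (_ || _).
  have E2 : (x ^+ 2 == -1) = (x == quarter) || (x == - quarter).
    by rewrite -i2 eqf_sqr.
  by rewrite sqrf_eq1 E2 -!orbA.
have /dvdnP[k Bk] := card_plus_orbits.
have cA : (#|A| + 5 = #|F|)%N.
  rewrite -(cardC (mem A)); congr addn.
  have <- : #|s| = 5%N by apply/card_uniqP.
  by apply: eq_card => x; rewrite As !inE.
have SA : \sum_(x in A) rho (x ^+ 3 + 1 * x) = 2 * #|B|%:R - #|A|%:R.
  rewrite -!sum1_card !natr_sum mulr_sumr.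
  rewrite [X in X - _](eq_bigl (fun x => (x \in A) && (rho (x ^+ 3 + x) == 1)))
    => [|x]; last by rewrite !inE.
  rewrite big_mkcondr -sumrB; apply: eq_bigr => x.
  rewrite !inE => /and3P[x0 _ x2]; rewrite mul1r.
  have nz : x ^+ 3 + x != 0.
    rewrite (_ : _ + _ = x * (x ^+ 2 + 1)); last by ring.
    by rewrite mulf_neq0 // addr_eq0.
  by case: (quad_char_neq0 nz) => ->.
have Ss : \sum_(x in s) rho (x ^+ 3 + 1 * x) = 2 * (-1) ^+ m.
  rewrite -(big_uniq _ U) /= !big_cons big_nil.
  have -> : (0 : F) ^+ 3 + 1 * 0 = 0 by ring.
  have -> : (1 : F) ^+ 3 + 1 * 1 = 2 by ring.
  have -> : (-1 : F) ^+ 3 + 1 * -1 = - 2 by ring.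
  have -> : quarter ^+ 3 + 1 * quarter = quarter * (quarter ^+ 2 + 1) by ring.
  have -> : (- quarter) ^+ 3 + 1 * - quarter = - (quarter * (quarter ^+ 2 + 1)) by ring.
  by rewrite i2 addNr mulr0 oppr0 quad_char0 quad_charN quad_char2; ring.
rewrite /jacobsthal (bigID (mem A)) /= SA (eq_bigl (fun x => x \in s)) => [|x]; last by rewrite As.
have Az : (#|A|%:R : int) = 4 * m%:R - 4 by move: cA; rewrite !natz; lia.
have mz : (m%:R : int) = (odd m)%:R + (m./2)%:R * 2 by rewrite !natz; lia.
rewrite Ss Bk Az mz natrM -signr_odd; case: (odd m).
  by exists (k%:R - (m./2)%:R); rewrite expr1 mulr1n; ring.
by exists (k%:R - (m./2)%:R + 1); rewrite expr0 mulr0n; ring.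
Qed.

End JacobsthalSums.

(** Since p divides (a y)^2 - (x b)^2, it divides a y - x b or a y + x b, say the
    former. In p^2 = (a b + x y)^2 + (a y - x b)^2 the first square is nonzero,
    as a b + x y is odd; so the second, a multiple of p^2, vanishes. *)
Lemma two_squares_unique (p : nat) (a x b y : int) :
  prime p -> p%:Z = a ^+ 2 + x ^+ 2 -> p%:Z = b ^+ 2 + y ^+ 2 ->
  ~~ (2 %| a)%Z -> (2 %| x)%Z -> ~~ (2 %| b)%Z -> (2 %| y)%Z ->
  a ^+ 2 = b ^+ 2.
Proof.
move=> p_pr pax pby a_odd x_even b_odd y_even.
have p0 : (0 < p%:Z) by rewrite ltz_nat prime_gt0.
wlog : y pby y_even / (p%:Z %| a * y - x * b)%Z => [W|].
  have : (p%:Z %| (a * y - x * b) * (a * y + x * b))%Z.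
    apply/dvdzP; exists (a ^+ 2 - b ^+ 2).
    rewrite (_ : (a ^+ 2 - b ^+ 2) * p%:Z = a ^+ 2 * p%:Z - p%:Z * b ^+ 2); last by ring.
    by rewrite {1}pby pax; ring.
  rewrite dvdzE abszM Euclid_dvdM // => /orP[pd|pd]; first exact: (W y).
  by apply: (W (- y)); rewrite ?sqrrN ?mulrN -?opprD ?rpredN.
move=> /dvdzP[k kE].
have nz : a * b + x * y != 0.
  apply/eqP=> e; have : ~~ (2 %| a * b + x * y)%Z.
    have ab_odd : ~~ (2 %| a * b)%Z.
      by rewrite dvdzE abszM Euclid_dvdM // negb_or; apply/andP.
    have xy_even : (2 %| x * y)%Z by apply: dvdz_mull.
    by rewrite rpredDr.
  by rewrite e dvdz0.
have N : (a * b + x * y) ^+ 2 + k ^+ 2 * p%:Z ^+ 2 = p%:Z ^+ 2.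
  by rewrite -exprMn -kE [in RHS]expr2 {1}pax pby; ring.
have k0 : k = 0.
  apply/eqP; apply/negPn/negP=> k0.
  have k1 : 1 <= k ^+ 2 by rewrite -gtz0_ge1 lt_def sqr_ge0 sqrf_eq0 k0.
  have s0 : 0 < (a * b + x * y) ^+ 2.
    by rewrite lt_def sqr_ge0 sqrf_eq0 nz.
  have : p%:Z ^+ 2 <= k ^+ 2 * p%:Z ^+ 2 by rewrite ler_peMl ?sqr_ge0.
  by rewrite -{1}N gerDr leNgt s0.
have e : a * y = x * b by apply/eqP; rewrite -subr_eq0 kE k0 mul0r.
apply: (@mulIf _ p%:Z); first by rewrite gt_eqF.
rewrite {1}pby pax.
have : a ^+ 2 * y ^+ 2 = x ^+ 2 * b ^+ 2 by rewrite -!exprMn e.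
by move=> {}e; rewrite mulrDr mulrDr e; ring.
Qed.

(** * Trace of Frobenius at a prime alpha^2 + x^2 *)
Section TwoSquarePrime.

Variables (F : finFieldType) (g : F) (alpha x : int).
Hypothesis g_prim : (#|F|.-1).-primitive_root g.
Hypothesis cardF_prime : prime #|F|.
Hypothesis cardFE : #|F|%:Z = alpha ^+ 2 + x ^+ 2.
Hypothesis alpha_mod4 : (alpha = 1 %[mod 4])%Z.
Hypothesis x_even : (2 %| x)%Z.

Lemma card_two_squares : exists m, #|F| = (4 * m).+1 /\ (odd m = ~~ (4 %| x)%Z).
Proof.
have [a aE] : exists a, alpha = a * 4 + 1.
  by exists (alpha %/ 4)%Z; rewrite {1}(divz_eq alpha 4) alpha_mod4.
have /dvdzP[y yE] := x_even.
exists (#|F| %/ 4)%N.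
have qE : #|F|%:Z = 4 * (2 * (2 * a ^+ 2 + a) + y ^+ 2) + 1.
  by rewrite cardFE aE yE; ring.
set z := y ^+ 2 in qE.
have yz : (2 %| z)%Z = (2 %| y)%Z by rewrite !dvdzE abszX Euclid_dvdX // andbT.
have -> : (4 %| x)%Z = (2 %| y)%Z by rewrite yE (@dvdz_mul2r 2 2 y).
rewrite -yz; clear yz; clearbody z; move: qE; move: (2 * a ^+ 2 + a) #|F| => w q.
by clear; lia.
Qed.

(** The congruence mod 8 fixes the sign of S(1): S(1) / 2 is an odd square root
    of alpha^2 that is 3 mod 4, hence is - alpha. *)
Lemma jacobsthal_two_squares :
  jacobsthal g 1 = - 2 * alpha /\
  (jacobsthal g g = 2 * x \/ jacobsthal g g = - (2 * x)).
Proof.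
have [m [cardF _]] := card_two_squares.
have [k S1] := jacobsthal1_mod8 g_prim cardF.
have := jacobsthal_sum_squares g_prim cardF.
rewrite natz {}S1; move: (jacobsthal g g) => s SS.
have q_odd : ~~ (2 %| #|F|%:Z)%Z by rewrite cardF; clear; lia.
have a_odd : ~~ (2 %| alpha)%Z by move: alpha_mod4; clear; lia.
move: cardF_prime cardFE q_odd SS; move: #|F| => q q_pr qE q_odd SS.
have /dvdzP[t tE] : (2 %| s)%Z.
  have : (2 %| s ^+ 2)%Z.
    by apply/dvdzP; exists (2 * q%:Z - 2 * (4 * k - 1) ^+ 2); lra.
  by rewrite !dvdzE abszX Euclid_dvdX // andbT.
have qE' : q%:Z = (4 * k - 1) ^+ 2 + t ^+ 2 by move: SS; rewrite tE; lra.
have t_even : (2 %| t)%Z.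
  have : (2 %| t ^+ 2)%Z.
    by move: (t ^+ 2) qE' q_odd; rewrite sqrrB; move: (k ^+ 2); clear; lia.
  by rewrite !dvdzE abszX Euclid_dvdX // andbT.
have k_odd : ~~ (2 %| 4 * k - 1)%Z by clear; lia.
have e := two_squares_unique q_pr qE qE' a_odd x_even k_odd t_even.
have kE : 4 * k - 1 = - alpha.
  by move/eqP: e; rewrite eqf_sqr; move: alpha_mod4; clear; lia.
split; first by lra.
have /eqP : t ^+ 2 = x ^+ 2 by move: qE'; rewrite qE kE; lra.
by rewrite eqf_sqr tE => /orP[] /eqP ->; [left|right]; ring.
Qed.

End TwoSquarePrime.

Lemma ap_jacobsthal (D : int) (p m : nat) (g : 'F_p) :
  (#|'F_p|.-1).-primitive_root g -> #|'F_p| = (4 * m).+1 -> prime p ->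
  ap D p = - jacobsthal g D%:~R.
Proof.
move=> g_prim cardF p_pr; rewrite /ap.
have -> : #|ED_points D p|%:Z = 1 + (p%:Z + jacobsthal g D%:~R).
  rewrite -sum1_card (bigD1 None) //= PoszD; congr (_ + _).
  rewrite (reindex_onto Some (fun o => odflt (0, 0) o)) /=; last by case.
  (* The affine points; the default (0, 0) of odflt is never reached. *)
  pose Q (x y : 'F_p) := y ^+ 2 == x ^+ 3 + D%:~R * x.
  rewrite (eq_bigl (fun P => predT P.1 && Q P.1 P.2)) => [|[x y]]; last first.
    by rewrite /= eqxx !andbT.
  rewrite -(pair_big_dep predT Q (fun _ _ => 1%N)) /= -natz natr_sum.
  under eq_bigr => x _ do
    rewrite sum1dep_card natz (card_square_roots g_prim cardF).
  by rewrite big_split /= sumr_const card_Fp // natz.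
by ring.
Qed.

Section QuarticTest.

Variables (p : nat) (g : 'F_p) (alpha x : int).
Hypothesis p_prime : prime p.
Hypothesis g_prim : (#|'F_p|.-1).-primitive_root g.
Hypothesis pE : p%:Z = alpha ^+ 2 + x ^+ 2.
Hypothesis alpha_mod4 : (alpha = 1 %[mod 4])%Z.
Hypothesis x_even : (2 %| x)%Z.

Lemma ap_two_squares (D : int) k : D%:~R = g ^+ k ->
  ap D p = if odd k then - jacobsthal g g * (-1) ^+ k./2 
           else 2 * alpha * (-1) ^+ k./2.
Proof.
have cF : #|'F_p| = p by apply: card_Fp.
have qE : #|'F_p|%:Z = alpha ^+ 2 + x ^+ 2 by rewrite cF.
have q_pr : prime #|'F_p| by rewrite cF.
have [m [cardF _]] := card_two_squares qE alpha_mod4 x_even.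
have [J1 _] := jacobsthal_two_squares g_prim q_pr qE alpha_mod4 x_even.
move=> Dk; rewrite (ap_jacobsthal D g_prim cardF p_prime) Dk.
have gk0 j : g ^+ j != 0 by rewrite expf_neq0 ?(prim_neq0 g_prim).
rewrite -{1}[k]odd_double_half exprD -muln2 exprM.
rewrite (jacobsthal_twist g_prim cardF) // mcharX ?(sign_char_order cardF) //.
by case: (odd k); rewrite ?expr1 ?expr0 ?J1; ring.
Qed.

(** For odd k the trace is 2x or -2x, which is not 2 alpha or -2 alpha because x
    is even and alpha odd. *)
Lemma ap_eq_twice (D : int) k (e : bool) : D%:~R = g ^+ k ->
  (ap D p == 2 * ((-1) ^+ e * alpha)) = (k %% 4 == 2 * e)%N.
Proof.
have cF : #|'F_p| = p by apply: card_Fp.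
have qE : #|'F_p|%:Z = alpha ^+ 2 + x ^+ 2 by rewrite cF.
have q_pr : prime #|'F_p| by rewrite cF.
have [_ Jg] := jacobsthal_two_squares g_prim q_pr qE alpha_mod4 x_even.
move=> /ap_two_squares ->.
have kE : (k %% 4 == 2 * e)%N = ~~ odd k && (odd k./2 == e).
  by case: e; clear; lia.
have a_odd : ~~ (2 %| alpha)%Z by move: alpha_mod4; clear; lia.
rewrite {}kE -(signr_odd _ k./2).
case: (odd k) => /=.
  apply/negbTE/eqP; case: (odd k./2); case: e;
    case: Jg => ->; move: x_even a_odd; clear; rewrite ?expr1 ?expr0 /=; lia.
by case: (odd k./2); case: e; move: a_odd; clear; rewrite ?expr1 ?expr0 /=; lia.
Qed.

End QuarticTest.

(** * Gauss and Jacobi sums with values in a field *)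
Section GaussSums.

Variables (F : finFieldType) (g : F) (K : fieldType) (e : F -> K).
Hypothesis g_prim : (#|F|.-1).-primitive_root g.
Hypothesis e0 : e 0 = 1.
Hypothesis eD : forall s t, e (s + t) = e s * e t.
Hypothesis sum_e : \sum_t e t = 0.

Definition gauss (w : K) : K := \sum_t mchar g w t * e t.

Definition jacobi (w w' : K) : K := \sum_t mchar g w t * mchar g w' (1 - t).

Lemma gauss_scale w a : w ^+ #|F|.-1 = 1 -> a != 0 ->
  \sum_t mchar g w t * e (a * t) = mchar g w a^-1 * gauss w.
Proof.
move=> w1 a0; rewrite (reindex_inj (mulfI (invr_neq0 a0))) /= mulr_sumr.
by apply: eq_bigr => t _; rewrite mulVKf // mcharM // mulrA.
Qed.

Lemma sum_additive_char a : \sum_t e (t * a) = #|F|%:R * (a == 0)%:R.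
Proof.
have [->|a0] := eqVneq a 0.
  by under eq_bigr => t _ do rewrite mulr0 e0; rewrite sumr_const mulr1.
by rewrite mulr0 -[RHS]sum_e [RHS](reindex_inj (mulIf a0)).
Qed.

(** Substituting t = u v, the inner sum over u != 0 of e (u (v + 1)) is q - 1 for
    v = -1 and -1 otherwise; the latter terms cancel since mchar g w sums to 0. *)
Lemma gauss_mulV w w' : w ^+ #|F|.-1 = 1 -> w * w' = 1 -> w != 1 ->
  gauss w * gauss w' = mchar g w (-1) * #|F|%:R.
Proof.
move=> w1 ww' wn1.
rewrite /gauss mulrC mulr_suml.
transitivity (\sum_u \sum_v mchar g w v * ((u != 0)%:R * e (u * (v + 1)))).
  apply: eq_bigr => u _; have [->|u0] := eqVneq u 0.
    rewrite mchar0 !mul0r big1 // => v _.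
    by rewrite mul0r mulr0.
  rewrite mulr_sumr (reindex_inj (mulfI u0)) /=; apply: eq_bigr => v _.
  rewrite mcharM // mulrDr mulr1 eD mul1r.
  have := mchar_mul g w w' u; rewrite ww' mchar_triv u0 => W.
  rewrite [RHS](_ : _ = mchar g w u * mchar g w' u * (mchar g w v * (e (u * v) * e u))).
    by ring.
  by rewrite W mul1r.
rewrite exchange_big /=.
have E v : \sum_u mchar g w v * ((u != 0)%:R * e (u * (v + 1))) =
    mchar g w v * (#|F|%:R * (v == -1)%:R) - mchar g w v.
  rewrite -mulr_sumr -[X in _ = _ - X]mulr1 -mulrBr; congr (_ * _).
  rewrite -addr_eq0 -sum_additive_char (bigD1 0) //= [in RHS](bigD1 0) //=.
  rewrite eqxx mul0r !mul0r e0 add0r addrAC subrr add0r.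
  by apply: eq_bigr => u /negPf->; rewrite mul1r.
rewrite (eq_bigr _ (fun v _ => E v)) sumrB (sum_mchar g_prim) // subr0.
rewrite (bigD1 (-1)) //= eqxx mulr1 big1 ?addr0 // => v /negPf->.
by rewrite !mulr0.
Qed.

(** Group the double sum by s = t + u. For s != 0 rescaling by s gives the Jacobi
    sum, and for s = 0 the inner sum is a complete sum of the nontrivial
    character mchar g (w * w'). *)
Lemma gauss_mul w w' : w ^+ #|F|.-1 = 1 -> w' ^+ #|F|.-1 = 1 ->
  w * w' != 1 -> gauss w * gauss w' = jacobi w w' * gauss (w * w').
Proof.
move=> w1 w1' ww'.
have ww1 : (w * w') ^+ #|F|.-1 = 1 by rewrite exprMn w1 w1' mulr1.
rewrite {1 2}/gauss mulr_suml.
transitivity (\sum_t \sum_s e s * (mchar g w t * mchar g w' (s - t))).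
  apply: eq_bigr => t _; rewrite mulr_sumr (reindex_inj (addIr (- t))) /=.
  apply: eq_bigr => s _; have -> : e s = e (s - t) * e t by rewrite -eD subrK.
  by ring.
rewrite exchange_big /= /gauss mulr_sumr; apply: eq_bigr => s _.
rewrite -mulr_sumr [RHS]mulrA [RHS]mulrC; congr (_ * _).
have [->|s0] := eqVneq s 0.
  rewrite mchar0 mulr0.
  under eq_bigr => t _ do rewrite sub0r -mulN1r mcharM // mulrCA mchar_mul.
  by rewrite -mulr_sumr (sum_mchar g_prim) ?mulr0.
rewrite (reindex_inj (mulfI s0)) /jacobi mulr_suml; apply: eq_bigr => t _.
have -> : s - s * t = s * (1 - t) by ring.
rewrite !mcharM // -(mchar_mul g w w'); ring.
Qed.

Lemma additive_char_exp n t : e t ^+ n = e (n%:R * t).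
Proof.
elim: n => [|n IHn]; first by rewrite expr0 mul0r e0.
by rewrite exprS IHn -eD; congr e; rewrite -[n.+1%:R]natr1; ring.
Qed.

(** In characteristic l the l-th power distributes over the sum; on the additive
    character it is the substitution t -> l t, undone by gauss_scale. *)
Lemma gauss_frobenius w l : l \in [pchar K] -> w ^+ #|F|.-1 = 1 ->
  l%:R != 0 :> F -> gauss w ^+ l = mchar g (w ^+ l) l%:R^-1 * gauss (w ^+ l).
Proof.
move=> lK w1 l0.
have wl1 : (w ^+ l) ^+ #|F|.-1 = 1 by rewrite exprAC w1 expr1n.
rewrite -gauss_scale // -(pFrobenius_autE lK) /gauss rmorph_sum /=.
have l1 : (0 < l)%N by rewrite prime_gt0 // (pcharf_prime lK).
apply: eq_bigr => t _; rewrite pFrobenius_autE exprMn additive_char_exp.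
by rewrite -(prednK l1) mchar_exp.
Qed.

End GaussSums.

(** * The quartic Gauss sum *)
Section QuarticGauss.

Variables (F : finFieldType) (g : F) (m : nat) (K : fieldType) (i : K).
Hypothesis g_prim : (#|F|.-1).-primitive_root g.
Hypothesis cardF : #|F| = (4 * m).+1.
Hypothesis sqr_i : i ^+ 2 = -1.
Hypothesis K2 : 2 != 0 :> K.

Let q1E : #|F|.-1 = (4 * m)%N. Proof. by rewrite cardF. Qed.
Let i1 : i ^+ #|F|.-1 = 1.
Proof. by rewrite q1E !exprM (exprM i 2 2) sqr_i sqrrN !expr1n. Qed.
Let s1 : (-1 : K) ^+ #|F|.-1 = 1. Proof. exact: sign_char_order cardF K. Qed.
Let i1' : (- i) ^+ #|F|.-1 = 1. Proof. by rewrite -mulN1r exprMn s1 i1 mulr1. Qed.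

Lemma neg1_neq1 : -1 != 1 :> K.
Proof. by rewrite -subr_eq0 -opprD oppr_eq0. Qed.

Let i_neq1 : i != 1.
Proof.
by apply: contraNneq neg1_neq1 => e; rewrite -sqr_i e expr1n.
Qed.

Let i_neqN1 : - i != 1.
Proof.
by apply: contraNneq neg1_neq1 => e; rewrite -sqr_i -sqrrN e expr1n.
Qed.

Let eps := mchar g i (-1).

Lemma quartic_neg1 : eps = (-1) ^+ m.
Proof.
by rewrite /eps (neg1_prim g_prim cardF) mcharX // exprM sqr_i.
Qed.

Let eps2 : eps ^+ 2 = 1.
Proof. by rewrite quartic_neg1 -exprM mulnC exprM sqrrN !expr1n. Qed.

Let r1 : mchar g (-1) (-1) = 1 :> K.
Proof. by move: eps2; rewrite /eps mchar_exp sqr_i. Qed.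

(** With a, b, c the Gauss sums of i, -1, - i: a b = J c, a c = eps q, b^2 = q and
    eps^2 = 1. Hence (a^2 b)^2 = (J a c)^2, that is a^4 q = J^2 q^2. *)
Lemma gauss_quartic_exp4 (e : F -> K) :
  e 0 = 1 -> (forall s t, e (s + t) = e s * e t) -> \sum_t e t = 0 ->
  #|F|%:R != 0 :> K ->
  gauss g e i * gauss g e (- i) = eps * #|F|%:R /\
  gauss g e i ^+ 4 = jacobi g i (-1) ^+ 2 * #|F|%:R.
Proof.
move=> e0 eD sum_e q0.
have ii : i * - i = 1 by rewrite mulrN -expr2 sqr_i opprK.
have G1 := gauss_mulV g_prim e0 eD sum_e i1 ii i_neq1.
split=> //.
have nn : -1 * -1 = 1 :> K by rewrite mulrNN mulr1.
have G2 := gauss_mulV g_prim e0 eD sum_e s1 nn neg1_neq1.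
have G3 : gauss g e i * gauss g e (-1) = jacobi g i (-1) * gauss g e (- i).
  by rewrite (gauss_mul g_prim eD i1 s1) mulrN1.
rewrite r1 mul1r in G2.
apply: (mulIf q0); rewrite -[X in _ * X]G2.
set a := gauss g e i in G1 G3 *; set b := gauss g e (-1) in G2 G3 *.
set c := gauss g e (- i) in G1 G3 *; set J := jacobi _ _ _ in G3 *.
have -> : a ^+ 4 * (b * b) = (a * (a * b)) ^+ 2 by ring.
rewrite G3 mulrCA G1 !exprMn eps2; ring.
Qed.

(** Jacobsthal sums split into these character sums according to the quartic
    characters i and - i, because 1 + rho(v) counts the square roots of v. *)
Let T (w : K) (D : F) : K := \sum_v mchar g w v * mchar g (-1) (v + D).

Let TE w D : w ^+ #|F|.-1 = 1 -> D != 0 ->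
  T w D = mchar g w (-1) * mchar g (- w) D * jacobi g w (-1).
Proof.
move=> w1 D0; have ND0 : - D != 0 by rewrite oppr_eq0.
rewrite /T (reindex_inj (mulfI ND0)) /jacobi mulr_sumr; apply: eq_bigr => v _.
have -> : - D * v + D = D * (1 - v) by ring.
have -> : mchar g (- w) D = mchar g w D * mchar g (-1) D.
  by rewrite mchar_mul mulrN1.
by rewrite -[- D]mulN1r !mcharM //; ring.
Qed.

Let jacobsthalE D : (jacobsthal g D)%:~R = T i D + T (- i) D.
Proof.
have sE x : (mchar g (-1 : int) x)%:~R = mchar g (-1) x :> K.
  by rewrite /mchar; case: eqP => // _; rewrite rmorphXn rmorphN1.
rewrite /jacobsthal rmorph_sum /=.
under eq_bigr => x _ do rewrite sE.
transitivity (\sum_x mchar g i (x ^+ 2) * mchar g (-1) (x ^+ 2 + D)).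
  apply: eq_bigr => x _; have -> : x ^+ 3 + D * x = x * (x ^+ 2 + D) by ring.
  by rewrite mcharM // [in RHS]expr2 mcharM // mchar_mul -expr2 sqr_i.
rewrite (partition_big (fun x => x ^+ 2) predT) //= -big_split /=.
apply: eq_bigr => v _.
rewrite (eq_bigr (fun=> mchar g i v * mchar g (-1) (v + D) * 1)); last first.
  by move=> x /eqP->; rewrite mulr1.
rewrite -mulr_sumr.
have -> : \sum_(x | x ^+ 2 == v) (1 : K) = 1 + mchar g (-1) v.
  rewrite -sE -(rmorph1 (intmul (1 : K))) -rmorphD /=.
  rewrite -(card_square_roots g_prim cardF v) -sum1dep_card.
  by rewrite -natz mulrz_nat natr_sum.
have -> : mchar g (- i) v = mchar g i v * mchar g (-1) v.
  by rewrite mchar_mul mulrN1.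
by ring.
Qed.

(** The twisted sums give S(1) = eps (J + J') and S(g) = eps (- i J + i J'), where
    J' is the Jacobi sum of the conjugate character - i; solve for J. *)
Lemma jacobi_jacobsthal :
  2 * jacobi g i (-1) =
  (-1) ^+ m * ((jacobsthal g 1)%:~R + i * (jacobsthal g g)%:~R).
Proof.
have g0 := prim_neq0 g_prim.
have N : mchar g (- i) (-1) = eps.
  by rewrite -[- i]mulrN1 -mchar_mul r1 mulr1.
have mg (w : K) : w ^+ #|F|.-1 = 1 -> mchar g w g = w.
  by move=> w1; rewrite -[RHS]expr1 -(mcharX g_prim 1 w1).
rewrite -quartic_neg1 !jacobsthalE !TE ?oner_neq0 // !opprK N !mg //.
rewrite !mchar_one // -/eps; set J := jacobi _ i _; set J' := jacobi _ (- i) _.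
have -> : eps * (eps * 1 * J + eps * 1 * J' + i * (eps * - i * J + eps * i * J')) =
  eps ^+ 2 * (J + J' - i ^+ 2 * J + i ^+ 2 * J') by ring.
by rewrite eps2 sqr_i; ring.
Qed.

End QuarticGauss.

Lemma closed_field_pchar l : prime l -> {K : closedFieldType | l \in [pchar K]}.
Proof.
move=> l_pr; have [K [f _]] := countable_algebraic_closure 'F_l.
by exists K; rewrite (fmorph_pchar f) pchar_Fp.
Qed.

(** A root of 1 + X + ... + X^(p-1) gives a nontrivial additive character. *)
Lemma exists_additive_char (K : closedFieldType) p : prime p -> p%:R != 0 :> K ->
  exists e : 'F_p -> K,
    [/\ e 0 = 1, forall s t, e (s + t) = e s * e t & \sum_t e t = 0].
Proof.
move=> p_pr p0; have pE : (Zp_trunc (pdiv p)).+2 = p := Fp_cast p_pr.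
pose P : {poly K} := \poly_(j < p) 1.
have /closed_rootP[z] : size P != 1%N.
  by rewrite size_poly_eq ?oner_neq0 // gtn_eqF // prime_gt1.
rewrite rootE horner_poly => /eqP sz.
have {}sz : \sum_(j < p) z ^+ j = 0.
  by rewrite -[RHS]sz; apply: eq_bigr => j _; rewrite mul1r.
have z1 : z ^+ p = 1 by apply/eqP; rewrite -subr_eq0 subrX1 sz mulr0.
exists (fun t => z ^+ t); split=> [|s t|]; first exact: expr0.
  have {}z1 : z ^+ (Zp_trunc (pdiv p)).+2 = 1 by rewrite pE.
  by rewrite -exprD -[RHS](expr_mod _ z1).
have H n : n = p -> \sum_(t < n) z ^+ t = 0 by move=> ->.
exact: H.
Qed.

(** An element with square -1 <> 1 has order exactly 4. *)
Lemma exp_quartic_eq (K : fieldType) (w : K) n (e : bool) :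
  w ^+ 2 = -1 -> (-1 : K) != 1 -> (w ^+ n == (-1) ^+ e) = (n %% 4 == 2 * e)%N.
Proof.
move=> w2 nn.
have w4 : w ^+ 4 = 1 by rewrite (exprM w 2 2) w2 sqrrN expr1n.
have w1 : w != 1 by apply: contraNneq nn => h; rewrite -w2 h expr1n.
have wN : w != -1 by apply: contraNneq nn => h; rewrite -w2 h sqrrN expr1n.
have wN1 : - w != 1 by rewrite eqr_oppLR.
have wNN : - w != - 1 by rewrite eqr_opp.
rewrite -(expr_mod n w4); have := ltn_pmod n (isT : (0 < 4)%N).
have w3 : w ^+ 3 = - w by rewrite exprS w2 mulrN1.
have nn' : 1 != -1 :> K by rewrite eq_sym.
by case: (n %% 4)%N => [|[|[|[|]]]] // _; case: e;
  rewrite ?expr0 ?expr1 ?w2 ?w3 ?eqxx //=; apply/negbTE.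
Qed.

Lemma int_frobenius (K : fieldType) l (n : int) :
  l \in [pchar K] -> (n%:~R : K) ^+ l = n%:~R.
Proof. by move=> lK; rewrite -(pFrobenius_autE lK) rmorph_int. Qed.

(** The image of the Gaussian integer a + b i, when i is sent to a square root of
    -1 in K. *)
Definition gint (K : fieldType) (i : K) (a b : int) : K := a%:~R + i * b%:~R.

(** The image of the conjugate a - b i. It is defined separately because
    gint i a b does not determine it when i lies in the prime field of K. *)
Definition gintC (K : fieldType) (i : K) (a b : int) : K := a%:~R - i * b%:~R.

Lemma gaussian_frobenius (K : fieldType) l (i s : K) (a b : int) :
  l \in [pchar K] -> i ^+ l = s * i ->
  gint i a b ^+ l = a%:~R + s * (i * b%:~R) /\
  gintC i a b ^+ l = a%:~R - s * (i * b%:~R).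
Proof.
move=> lK il; rewrite /gint /gintC -!(pFrobenius_autE lK) rmorphB rmorphD rmorphM /=.
by rewrite !pFrobenius_autE !int_frobenius // il mulrA.
Qed.

Lemma exp_quartic_1mod4 (K : fieldType) (i : K) k :
  i ^+ 2 = -1 -> i ^+ (4 * k).+1 = i.
Proof.
by move=> i2; rewrite exprS !exprM (exprM i 2 2) i2 sqrrN !expr1n mulr1.
Qed.

Lemma exp_quartic_3mod4 (K : fieldType) (i : K) l k :
  i ^+ 2 = -1 -> l.+1 = (4 * k)%N -> i ^+ l = - i.
Proof.
move=> i2 lE; have i0 : i != 0.
  by apply: contraNneq (oner_neq0 K) => h; rewrite -oppr_eq0 -i2 h expr0n.
apply: (mulfI i0); rewrite -exprS lE !exprM (exprM i 2 2) i2 sqrrN !expr1n.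
by rewrite mulrN -expr2 i2 opprK.
Qed.

(** * Quartic reciprocity for a prime l modulo alpha^2 + x^2 *)
Section QuarticReciprocity.

Variables (l p : nat) (K : closedFieldType) (i : K) (g : 'F_p) (alpha x : int).
Hypothesis lK : l \in [pchar K].
Hypothesis l_odd : odd l.
Hypothesis p_prime : prime p.
Hypothesis p_neq_l : p != l.
Hypothesis g_prim : (#|'F_p|.-1).-primitive_root g.
Hypothesis pE : p%:Z = alpha ^+ 2 + x ^+ 2.
Hypothesis alpha_mod4 : (alpha = 1 %[mod 4])%Z.
Hypothesis x_even : (2 %| x)%Z.
Hypothesis sqr_i : i ^+ 2 = -1.

Local Notation z := (gint i alpha x).
Local Notation z' := (gintC i alpha x).

Let l_prime : prime l. Proof. exact: pcharf_prime lK. Qed.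

Let K2 : 2 != 0 :> K.
Proof.
rewrite -(dvdn_pcharf lK) dvdn_prime2 //.
by apply: contraL l_odd => /eqP->.
Qed.

Let p0 : p%:R != 0 :> K.
Proof. by rewrite -(dvdn_pcharf lK) dvdn_prime2 // eq_sym. Qed.

Let zz' : z * z' = p%:R.
Proof.
have -> : (p%:R : K) = (p%:Z)%:~R by rewrite -natz mulrz_nat.
rewrite pE rmorphD !rmorphXn /=.
rewrite (_ : z * z' = alpha%:~R ^+ 2 - i ^+ 2 * x%:~R ^+ 2); last by rewrite /gint /gintC; ring.
by rewrite sqr_i; ring.
Qed.

Let c_eq (c w : K) (e : bool) n : w ^+ 2 = -1 -> c * w ^+ n = 1 ->
  (c == (-1) ^+ e) = (n %% 4 == 2 * e)%N.
Proof.
move=> w2 cw; have w0 : w ^+ n != 0.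
  by apply: contraNneq (oner_neq0 K) => h; rewrite -cw h mulr0.
rewrite -(exp_quartic_eq n e w2 (neg1_neq1 K2)).
rewrite -(inj_eq (mulIf w0)) cw.
have ss : (-1 : K) ^+ e * (-1) ^+ e = 1 by case: (e); rewrite ?mulrNN ?mulr1.
rewrite -[X in X == _]ss.
have s0 : (-1 : K) ^+ e != 0 by rewrite signr_eq0.
by rewrite (inj_eq (mulfI s0)) eq_sym.
Qed.

(** What both cases share. The sign of S(g) decides which of z and z' is u; as the
    conclusions only involve the values 1 and -1 of the quartic symbol, the
    exchange of z and z', which inverts the symbol, is harmless. The scalar c is
    the value of the l-th power of the quartic character at 1 / l. *)
Lemma quartic_reciprocity_core :
  exists m (G G' u u' : K), 
  [/\ odd m = ~~ (4 %| x)%Z, ((u, u') = (z, z') \/ (u, u') = (z', z)),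
      G * G' = (-1) ^+ m * p%:R, G ^+ 4 = u ^+ 3 * u' &
      forall kappa, l%:R = g ^+ kappa -> 
      (i ^+ l = i -> exists c, c * i ^+ kappa = 1 /\ G ^+ l = c * G) /\
      (i ^+ l = - i -> exists c, c * (- i) ^+ kappa = 1 /\ G ^+ l = c * G')].
Proof.
have cF : #|'F_p| = p by apply: card_Fp.
have qE : #|'F_p|%:Z = alpha ^+ 2 + x ^+ 2 by rewrite cF.
have q_pr : prime #|'F_p| by rewrite cF.
have [m [cardF m_odd]] := card_two_squares qE alpha_mod4 x_even.
have [J1 Jg] := jacobsthal_two_squares g_prim q_pr qE alpha_mod4 x_even.
have [e [e0 eD sum_e]] := exists_additive_char p_prime p0.
have q0 : #|'F_p|%:R != 0 :> K by rewrite cF.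
have [GG G4] := gauss_quartic_exp4 g_prim cardF sqr_i K2 e0 eD sum_e q0.
have JJ := jacobi_jacobsthal g_prim cardF sqr_i.
rewrite (quartic_neg1 g_prim cardF sqr_i) cF in GG.
rewrite cF in G4.
set G := gauss g e i in GG G4; set G' := gauss g e (- i) in GG.
set J := jacobi g i (-1) in G4 JJ.
have s2 : ((-1 : K) ^+ m) ^+ 2 = 1 by rewrite -exprM mulnC exprM sqrrN !expr1n.
have [u [u' [uu' J2]]] : exists u u' : K,
    ((u, u') = (z, z') \/ (u, u') = (z', z)) /\ J ^+ 2 = u ^+ 2.
  have K4 : (2 : K) ^+ 2 != 0 by rewrite expf_neq0.
  case: Jg => Jg; rewrite J1 Jg in JJ.
    exists z', z; split; first by right.
    apply: (mulfI K4); rewrite -exprMn JJ exprMn s2 /gintC !rmorphM !rmorphN /=.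
    by ring.
  exists z, z'; split; first by left.
  apply: (mulfI K4); rewrite -exprMn JJ exprMn s2 /gint !(rmorphM, rmorphN) /=.
  by ring.
exists m, G, G', u, u'; split=> //.
  rewrite G4 J2 -zz'; case: uu' => -[-> ->]; ring.
move=> kappa lk.
have l0 : l%:R != 0 :> 'F_p.
  by rewrite lk expf_neq0 // (prim_neq0 g_prim).
have [i1 i1'] : i ^+ #|'F_p|.-1 = 1 /\ (- i) ^+ #|'F_p|.-1 = 1.
  by rewrite cardF /= !exprM (exprM i 2 2) (exprM (- i) 2 2) sqrrN sqr_i sqrrN !expr1n.
have F := gauss_frobenius g_prim e0 eD lK i1 l0.
split=> il; rewrite il -/G -/G' in F.
  exists (mchar g i l%:R^-1); split=> //.
  by have := mcharV g_prim (l%:R) i1; rewrite l0 mulrC {2}lk mcharX.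
exists (mchar g (- i) l%:R^-1); split=> //.
by have := mcharV g_prim (l%:R) i1'; rewrite l0 mulrC {2}lk mcharX.
Qed.

(** Here Frobenius fixes i, so u^(l-1) = 1 and G^(l-1) = c. Thus
    c = (u^3 u')^k = (u'/u)^k. *)
Lemma quartic_reciprocity_1mod4 k kappa (e : bool) : l = (4 * k).+1 ->
  l%:R = g ^+ kappa ->
  (z' ^+ k == (-1) ^+ e * z ^+ k) = (kappa %% 4 == 2 * e)%N.
Proof.
move=> lE lk.
have [m [G [G' [u [u' [_ uu' GG G4 /(_ _ lk)[W _]]]]]]] := quartic_reciprocity_core.
have il : i ^+ l = i by rewrite lE exp_quartic_1mod4.
have [c [ci Gl]] := W il.
have [zl z'l] : z ^+ l = z /\ z' ^+ l = z'.
  rewrite /gint /gintC; have := @gaussian_frobenius _ _ i 1 alpha x lK.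
  by rewrite !mul1r => /(_ il).
have [z0 z0'] : z != 0 /\ z' != 0.
  by apply/andP; rewrite -negb_or -mulf_eq0 zz'.
have uk : u' ^+ k = c * u ^+ k.
  have ul : u ^+ l = u by case: uu' => -[-> _].
  have u0 : u != 0 by case: uu' => -[-> _].
  have G0 : G != 0.
    apply: contraNneq p0 => G0; move: GG; rewrite G0 mul0r => /esym/eqP.
    by rewrite mulf_eq0 expf_eq0 oppr_eq0 oner_eq0 andbF.
  have Gk : (u ^+ 3 * u') ^+ k = c.
    by apply: (mulIf G0); rewrite -G4 -exprM -exprSr -lE.
  have u4 : u ^+ (4 * k) = 1 by apply: (mulfI u0); rewrite -exprS -lE mulr1.
  rewrite -Gk exprMn -exprM mulrAC -exprD.
  by rewrite (_ : 3 * k + k = 4 * k)%N ?u4 ?mul1r // -mulSnr.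
rewrite -(c_eq e sqr_i ci).
case: uu' uk => -[-> ->] uk.
  by rewrite uk (inj_eq (mulIf _)) // expf_neq0.
rewrite uk mulrA -{1}[z' ^+ k]mul1r (inj_eq (mulIf _)) ?expf_neq0 //.
by case: (e); rewrite ?expr1 ?expr0 ?mul1r ?mulN1r 1?eq_sym // eqr_oppLR.
Qed.

(** Here Frobenius exchanges u and u', so u^(l+1) = u u' = p, while
    G^(l+1) = c G' G = c (-1)^m p. Thus (u^3 u')^k = c (-1)^m p, which is
    (u'/u)^k = c (-1)^m. *)
Lemma quartic_reciprocity_3mod4 k kappa (e : bool) : l.+1 = (4 * k)%N ->
  l%:R = g ^+ kappa ->
  (z' ^+ k == (-1) ^+ (e (+) ~~ (4 %| x)%Z) * z ^+ k) = (kappa %% 4 == 2 * e)%N.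
Proof.
move=> lE lk.
have [m [G [G' [u [u' [m_odd uu' GG G4 /(_ _ lk)[_ W]]]]]]] := quartic_reciprocity_core.
have il : i ^+ l = - i := exp_quartic_3mod4 sqr_i lE.
have [c [ci Gl]] := W il.
have [zl z'l] : z ^+ l = z' /\ z' ^+ l = z.
  rewrite /gint /gintC; have := @gaussian_frobenius _ _ i (-1) alpha x lK.
  by rewrite !mulN1r opprK => /(_ il).
have [z0 z0'] : z != 0 /\ z' != 0.
  by apply/andP; rewrite -negb_or -mulf_eq0 zz'.
have uk : u' ^+ k = c * (-1) ^+ m * u ^+ k.
  have ul : u ^+ (4 * k) = p%:R.
    by rewrite -lE exprSr -zz'; case: uu' => -[-> _]; rewrite ?zl ?z'l // mulrC.
  have Gk : (u ^+ 3 * u') ^+ k = c * (-1) ^+ m * p%:R.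
    by rewrite -G4 -exprM -lE exprSr Gl -!mulrA -GG [G * G']mulrC.
  apply: (mulfI p0); rewrite -{1}ul mulrA [p%:R * _]mulrC -Gk exprMn -exprM.
  by rewrite mulrAC -exprD -mulSnr.
rewrite -(c_eq e (etrans (sqrrN i) sqr_i) ci).
have mE : (-1 : K) ^+ (e (+) ~~ (4 %| x)%Z) = (-1) ^+ e * (-1) ^+ m.
  by rewrite signr_addb -m_odd signr_odd.
have s2 : ((-1 : K) ^+ m) ^+ 2 = 1 by rewrite -exprM mulnC exprM sqrrN !expr1n.
have sm0 : (-1 : K) ^+ m != 0 by rewrite expf_neq0 // oppr_eq0 oner_eq0.
rewrite {}mE; case: uu' uk => -[-> ->] uk.
  by rewrite uk !(inj_eq (mulIf _)) // expf_neq0.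
rewrite uk mulrA -{1}[z' ^+ k]mul1r (inj_eq (mulIf _)) ?expf_neq0 //.
have -> : (-1) ^+ e * (-1) ^+ m * (c * (-1) ^+ m) =
    (-1) ^+ e * c * ((-1) ^+ m) ^+ 2 by ring.
rewrite s2 mulr1.
by case: (e); rewrite ?expr1 ?expr0 ?mul1r ?mulN1r 1?eq_sym // eqr_oppLR.
Qed.

End QuarticReciprocity.

(** * Residues modulo l with a given quartic symbol *)
Section QuarticResidueCount.

Variables (l k : nat) (K : fieldType) (i : K) (alpha : int).
Hypothesis lK : l \in [pchar K].
Hypothesis l_odd : odd l.
Hypothesis alpha_l : ~~ (l%:Z %| alpha)%Z.
Hypothesis sqr_i : i ^+ 2 = -1.
Hypothesis lE : l = (4 * k).+1 \/ l.+1 = (4 * k)%N.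

Local Notation z c := (gint i alpha (Posz c)).
Local Notation z' c := (gintC i alpha (Posz c)).
Let w (c : nat) := z' c / z c.

Let l_prime : prime l. Proof. exact: pcharf_prime lK. Qed.

Let K2 : 2 != 0 :> K.
Proof.
rewrite -(dvdn_pcharf lK) dvdn_prime2 //.
by apply: contraL l_odd => /eqP->.
Qed.

Lemma int_pchar_eq0 (n : int) : (n%:~R == 0 :> K) = (l%:Z %| n)%Z.
Proof. by rewrite (dvdz_pcharf lK). Qed.

Let a0 : alpha%:~R != 0 :> K. Proof. by rewrite int_pchar_eq0. Qed.

Let i0 : i != 0.
Proof.
by apply: contraNneq (oner_neq0 K) => h; rewrite -oppr_eq0 -sqr_i h expr0n.
Qed.

Let zz' c : z c * z' c = (alpha ^+ 2 + c%:Z ^+ 2)%:~R.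
Proof.
rewrite rmorphD !rmorphXn /=.
rewrite (_ : z c * z' c = alpha%:~R ^+ 2 - i ^+ 2 * c%:Z%:~R ^+ 2); last first.
  by rewrite /gint /gintC; ring.
by rewrite sqr_i; ring.
Qed.

Definition admissible (c : nat) := ~~ (l%:Z %| alpha ^+ 2 + c%:Z ^+ 2)%Z.

Let admE c : admissible c -> z c != 0 /\ z' c != 0.
Proof.
by rewrite /admissible -int_pchar_eq0 -zz' mulf_eq0 negb_or => /andP.
Qed.

Let k_gt0 : (0 < k)%N.
Proof. by case: lE (prime_gt1 l_prime) => h; move: h l_odd; clear; lia. Qed.

Let w4k c : admissible c -> w c ^+ (4 * k) = 1.
Proof.
move=> /admE[z0 z0']; rewrite expr_div_n.
suff -> : z' c ^+ (4 * k) = z c ^+ (4 * k) by rewrite divff // expf_neq0.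
case: lE => h.
  have il : i ^+ l = 1 * i by rewrite h exp_quartic_1mod4 // mul1r.
  have [zl zl'] := gaussian_frobenius alpha c%:Z lK il.
  have -> : z' c ^+ (4 * k) = 1.
    by apply: (mulfI z0'); rewrite -exprS -h [LHS]zl' mul1r mulr1.
  by apply: (mulfI z0); rewrite -exprS -h [RHS]zl mul1r mulr1.
have il : i ^+ l = -1 * i by rewrite (exp_quartic_3mod4 sqr_i h) mulN1r.
have [zl zl'] := gaussian_frobenius alpha c%:Z lK il.
rewrite -h !exprSr [z' c ^+ l]zl' [z c ^+ l]zl !mulN1r opprK -/(gint i alpha c) -/(gintC i alpha c).
by rewrite mulrC.
Qed.

Let w_inj c d : admissible c -> admissible d -> (c < l)%N -> (d < l)%N ->
  w c = w d -> c = d.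
Proof.
move=> /admE[zc0 _] /admE[zd0 _] cl dl /eqP; rewrite /w eqr_div // => /eqP e.
have : 2 * i * alpha%:~R * (d%:Z%:~R - c%:Z%:~R) = 0 :> K.
  rewrite (_ : _ * _ = z' c * z d - z' d * z c); last by rewrite /gint /gintC; ring.
  by rewrite e subrr.
move/eqP; rewrite !mulf_eq0 (negPf K2) (negPf i0) (negPf a0) /= -rmorphB /=.
rewrite int_pchar_eq0; move: cl dl; clear => cl dl /dvdzP[q qE].
have q0 : q = 0 by nia.
by move: qE; rewrite q0 mul0r; lia.
Qed.

Let w_neqN1 c : admissible c -> w c != -1.
Proof.
move=> /admE[zc0 _]; rewrite /w -subr_eq0 opprK.
rewrite (_ : _ + 1 = (2 * alpha%:~R) / z c); last first.
  by rewrite -[X in _ + X](divff zc0) -mulrDl; congr (_ / _); rewrite /gint /gintC; ring.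
by rewrite !mulf_neq0 ?invr_eq0.
Qed.

Definition quartic_class (v : K) := [set c : 'I_l | admissible c && (w c ^+ k == v)].

(** The values w c are distinct roots of X^k - v and none of them is -1, which is
    itself a root when v = (-1)^k. *)
Let card_class v : (#|quartic_class v| + ((-1) ^+ k == v) <= k)%N.
Proof.
pose s := [seq w (c : 'I_l) | c in quartic_class v] ++ 
          nseq ((-1) ^+ k == v) (-1).
have sz : size ('X^k - v%:P) = k.+1 by rewrite size_XnsubC.
have -> : (#|quartic_class v| + ((-1) ^+ k == v))%N = size s.
  by rewrite size_cat size_map size_nseq cardE.
rewrite -ltnS -sz; apply: max_poly_roots.
- by rewrite -size_poly_eq0 sz.
- apply/allP=> y; rewrite mem_cat => /orP[/fintype.imageP[c]|].
    by rewrite inE => /andP[_ /eqP cv] ->; rewrite rootE !hornerE cv subrr.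
  rewrite mem_nseq => /andP[+ /eqP->]; rewrite lt0b => /eqP <-.
  by rewrite rootE !hornerE subrr.
rewrite cat_uniq; apply/and3P; split.
- rewrite map_inj_in_uniq ?enum_uniq // => c d; rewrite !mem_enum !inE.
  by move=> /andP[ca _] /andP[da _] /(w_inj ca da) e; apply/val_inj/e.
- apply/hasPn=> y; rewrite mem_nseq => /andP[_ /eqP->].
  apply/negP=> /fintype.imageP[c]; rewrite inE => /andP[ca _] /esym/eqP.
  by rewrite (negPf (w_neqN1 ca)).
- by case: (_ == _).
Qed.

Let adm := [set c : 'I_l | admissible c].

(** For l = 4k + 1 at most the two roots of X^2 + alpha^2 are excluded. For
    l = 4k - 1 nothing is: conjugation is Frobenius, so z c = 0 would force
    z' c = 0 and 2 alpha = 0. *)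
Let card_adm_ge : (4 * k <= #|adm|.+1)%N.
Proof.
have cA : (#|adm| + #|~: adm| = l)%N by rewrite cardsC card_ord.
case: lE => h.
  suff : (#|~: adm| <= 2)%N by move: cA h; move: #|adm| #|~: adm| => u v; clear; lia.
  pose s := [seq ((c : 'I_l)%:Z%:~R : K) | c in ~: adm].
  have -> : #|~: adm| = size s by rewrite size_map cardE.
  have sz : size ('X^2 - (- alpha%:~R ^+ 2 : K)%:P) = 3%N by rewrite size_XnsubC.
  rewrite -ltnS -sz; apply: max_poly_roots.
  - by rewrite -size_poly_eq0 sz.
  - apply/allP=> y /fintype.imageP[c]; rewrite !inE negbK => ca ->.
    rewrite rootE !hornerE opprK addrC -!rmorphXn -rmorphD /=.
    by rewrite int_pchar_eq0.
  rewrite map_inj_in_uniq ?enum_uniq // => c d _ _ /eqP.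
  rewrite -subr_eq0 -rmorphB /= int_pchar_eq0 => /dvdzP[q qE].
  apply/val_inj => /=; move: (ltn_ord c) (ltn_ord d) qE; clear => cl dl qE.
  have q0 : q = 0 by nia.
  by move: qE; rewrite q0 mul0r; lia.
suff -> : adm = [set: _] by rewrite cardsT card_ord -h.
apply/setP=> c; rewrite !inE /admissible -int_pchar_eq0 -zz' mulf_eq0 negb_or.
have il : i ^+ l = -1 * i by rewrite (exp_quartic_3mod4 sqr_i h) mulN1r.
have [zl zl'] := gaussian_frobenius alpha c%:Z lK il.
have zs : z c + z' c != 0.
  by rewrite (_ : _ + _ = 2 * alpha%:~R) ?mulf_neq0 // /gint /gintC; ring.
have l0 : (0 < l)%N by apply: prime_gt0.
apply/andP; split; apply: contraNneq zs => zc.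
  move: zl; rewrite -/(gint i alpha c) zc expr0n gtn_eqF // mulN1r.
  by rewrite -/(gintC i alpha c) => <-; rewrite addr0.
move: zl'; rewrite -/(gintC i alpha c) zc expr0n gtn_eqF // mulN1r opprK.
by rewrite -/(gint i alpha c) => <-; rewrite addr0.
Qed.

Let adm_cover : (#|adm| <= #|quartic_class 1| + #|quartic_class (-1)|
   + #|quartic_class i| + #|quartic_class (- i)|)%N.
Proof.
have E (A : {set 'I_l}) : #|A| = (\sum_c (c \in A))%N.
  by rewrite -sum1_card big_mkcond; apply: eq_bigr => c _; case: (c \in A).
rewrite !E -!big_split /=; apply: leq_sum => c _.
rewrite !inE; case ca : (admissible c) => //=.
have := w4k ca; rewrite mulnC exprM; set v := w c ^+ k => /eqP.
rewrite (exprM v 2 2) sqrf_eq1 => /orP[].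
  by rewrite sqrf_eq1 => /orP[] /eqP->; rewrite eqxx //; case: (_ == _).
by rewrite -sqr_i eqf_sqr => /orP[] /eqP->; rewrite eqxx // ?addnS.
Qed.

(** The four upper bounds of card_class add up to at most 4k - 1, the lower bound
    for their union, so all of them are equalities. *)
Let card_all : [/\ #|adm|.+1 = (4 * k)%N,
  (#|quartic_class 1| + ~~ odd k = k)%N &
  (#|quartic_class (-1)| + odd k = k)%N].
Proof.
have := card_class 1; have := card_class (-1).
have := card_class i; have := card_class (- i).
move: adm_cover card_adm_ge.
have nn := neg1_neq1 K2.
rewrite -!(signr_odd K k); case: (odd k) => /=; rewrite ?expr1 ?expr0 ?eqxx.
  by rewrite (negPf nn); clear; split; lia.
by rewrite [1 == -1]eq_sym (negPf nn); clear; split; lia.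
Qed.

Lemma card_admissible : #|[set c : 'I_l | admissible c]|.+1 = (4 * k)%N.
Proof. by case: card_all. Qed.

Lemma card_quartic_residues (e : bool) :
  (#|[set c : 'I_l | admissible c && (z' c ^+ k == (-1) ^+ e * z c ^+ k)%R]|
    + (odd k == e) = k)%N.
Proof.
have -> : [set c : 'I_l | admissible c && (z' c ^+ k == (-1) ^+ e * z c ^+ k)%R] =
    quartic_class ((-1) ^+ e).
  apply/setP=> c; rewrite !inE; case ca : (admissible c) => //=.
  have [z0 _] := admE ca; rewrite /w expr_div_n.
  by rewrite -[in RHS](inj_eq (mulIf (expf_neq0 k z0))) divfK ?expf_neq0.
have [_ c1 cN] := card_all.
by case: e; rewrite ?expr1 ?expr0 ?eqb_id ?eqbF_neg.
Qed.

End QuarticResidueCount.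

(** * Partial summation and the character modulo 4 *)
Section AbelSummation.

Variable R : realType.
Implicit Types (u f : nat -> R) (B : R).

(** Induction on n in the sharper form that compares the sum with its boundary
    term U(n) f(n), U being the partial sums of u; the error is at most
    B (f m - f n). *)
Lemma abel_bound u f B m :
  (forall n, `|\sum_(m <= k < n) u k| <= B) ->
  (forall k, (m <= k)%N -> 0 <= f k) ->
  (forall k, (m <= k)%N -> f k.+1 <= f k) ->
  forall n, `|\sum_(m <= k < n) u k * f k| <= B * f m.
Proof.
move=> uB f0 fS n.
have B0 : 0 <= B by apply: le_trans (uB m).
have [nm|/ltnW mn] := leqP n m.
  by rewrite big_geq // normr0 mulr_ge0 ?f0.
suff H : `|\sum_(m <= k < n) u k * f k - (\sum_(m <= k < n) u k) * f n|
    <= B * (f m - f n).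
  rewrite -[X in `|X|](subrK ((\sum_(m <= k < n) u k) * f n)).
  apply: (le_trans (ler_normD _ _)).
  rewrite -[X in _ <= B * X](subrK (f n)) mulrDr lerD //.
  by rewrite normrM [`|f n|]ger0_norm ?f0 // ler_wpM2r ?f0.
elim: n mn => [|n IHn] mn.
  by move: mn; rewrite leqn0 => /eqP->; rewrite !big_geq // mul0r !subrr normr0 mulr0.
move: mn; rewrite leq_eqVlt => /orP[/eqP->|mn].
  by rewrite !big_geq // mul0r !subrr normr0 mulr0.
rewrite (_ : _ - _ = (\sum_(m <= k < n) u k * f k - (\sum_(m <= k < n) u k) * f n)
   + (\sum_(m <= k < n.+1) u k) * (f n - f n.+1)); last first.
  by rewrite !(big_nat_recr n) //=; ring.
apply: (le_trans (ler_normD _ _)).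
rewrite (_ : B * _ = B * (f m - f n) + B * (f n - f n.+1)); last by ring.
apply: lerD; first exact: IHn.
rewrite normrM [X in _ * X]ger0_norm ?subr_ge0 ?fS //.
by rewrite ler_wpM2r ?subr_ge0 ?fS.
Qed.

End AbelSummation.

Definition chi4 (n : nat) : int :=
  if odd n then if (n %% 4 == 1)%N then 1 else -1 else 0.

Lemma chi4_mod n : chi4 (n %% 4) = chi4 n.
Proof. by rewrite /chi4 modn_mod odd_mod. Qed.

Lemma chi4M m n : chi4 (m * n) = chi4 m * chi4 n.
Proof.
rewrite -[LHS]chi4_mod -modnMm chi4_mod -(chi4_mod m) -(chi4_mod n).
have := ltn_pmod n (isT : (0 < 4)%N); have := ltn_pmod m (isT : (0 < 4)%N).
by case: (m %% 4)%N => [|[|[|[|]]]] // _; case: (n %% 4)%N => [|[|[|[|]]]].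
Qed.

Lemma chi4_le1 n : `|chi4 n| <= 1.
Proof. by rewrite /chi4; case: odd => //; case: eqP. Qed.

Lemma sum_chi4 n : \sum_(0 <= k < n) chi4 k = (2 <= n %% 4)%N%:R.
Proof.
elim: n => [|n IHn]; first by rewrite big_geq.
rewrite big_nat_recr //= IHn -chi4_mod -[n.+1]addn1 -modnDml.
have := ltn_pmod n (isT : (0 < 4)%N).
by case: (n %% 4)%N => [|[|[|[|]]]].
Qed.

Lemma sum_chi4_le1 m n : `|\sum_(m <= k < n) chi4 k| <= 1.
Proof.
have [nm|/ltnW mn] := leqP n m; first by rewrite big_geq.
have := sum_chi4 n; rewrite (@big_cat_nat _ _ _ m) //= sum_chi4.
by move: (\sum_(m <= k < n) chi4 k) => s; case: (2 <= _)%N; case: (2 <= _)%N; clear; lia.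
Qed.

(** * Chebyshev's bound *)
Section VonMangoldt.

Variable R : realType.
Implicit Types F G : nat -> R.

Local Notation lnn n := (ln (n%:R : R)).

Let lnn_ge0 n : 0 <= lnn n.
Proof.
case: n => [|n]; first by rewrite ln0.
by rewrite ln_ge0 // ler1n.
Qed.

(** The sum of Lambda(d) F(d) for the von Mangoldt function Lambda, over the prime
    powers p^j with p, j <= N. This range contains every prime power up to N, so
    F can encode any cutoff d <= n with n <= N. *)
Definition mangoldt_sum N F : R :=
  \sum_(0 <= p < N.+1 | prime p) \sum_(1 <= j < N.+1) lnn p * F (p ^ j)%N.

Lemma le_mangoldt_sum N F G : (forall d, (0 < d)%N -> F d <= G d) ->
  mangoldt_sum N F <= mangoldt_sum N G.
Proof.
move=> FG; apply: ler_sum => p p_pr; apply: ler_sum => j _.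
by rewrite ler_wpM2l // FG // expn_gt0 prime_gt0.
Qed.

Lemma eq_mangoldt_sum N F G : (forall d, (0 < d)%N -> F d = G d) ->
  mangoldt_sum N F = mangoldt_sum N G.
Proof. by move=> FG; apply/eqP; rewrite eq_le !le_mangoldt_sum // => d /FG->. Qed.

Lemma norm_mangoldt_sum N F :
  `|mangoldt_sum N F| <= mangoldt_sum N (fun d => `|F d|).
Proof.
apply: (le_trans (ler_norm_sum _ _ _)); apply: ler_sum => p _.
apply: (le_trans (ler_norm_sum _ _ _)); apply: ler_sum => j _.
by rewrite normrM ger0_norm.
Qed.

Lemma mangoldt_sumD N F G :
  mangoldt_sum N (fun d => F d + G d) = mangoldt_sum N F + mangoldt_sum N G.
Proof.
rewrite -big_split; apply: eq_bigr => p _; rewrite -big_split.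
by apply: eq_bigr => j _; rewrite mulrDr.
Qed.

Lemma mangoldt_sumZ N c F :
  mangoldt_sum N (fun d => c * F d) = c * mangoldt_sum N F.
Proof.
rewrite /mangoldt_sum mulr_sumr; apply: eq_bigr => p _; rewrite mulr_sumr.
by apply: eq_bigr => j _; rewrite mulrCA.
Qed.

Lemma mangoldt_sum_sum N (s : seq nat) (F : nat -> nat -> R) :
  \sum_(k <- s) mangoldt_sum N (F k) =
  mangoldt_sum N (fun d => \sum_(k <- s) F k d).
Proof.
rewrite /mangoldt_sum exchange_big; apply: eq_bigr => p _.
by rewrite exchange_big; apply: eq_bigr => j _; rewrite mulr_sumr.
Qed.

Let ln_prodn (s : seq nat) (P : pred nat) (F : nat -> nat) :
  (forall k, P k -> 0 < F k)%N ->
  lnn (\prod_(k <- s | P k) F k)%N = \sum_(k <- s | P k) lnn (F k).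
Proof.
move=> F0; elim: s => [|k s IHs]; first by rewrite !big_nil ln1.
rewrite !big_cons; case: ifP => // Pk.
have P0 : (0 < \prod_(j <- s | P j) F j)%N by rewrite prodn_cond_gt0.
by rewrite natrM lnM ?posrE ?ltr0n ?F0 // IHs.
Qed.

Let sum_leq L N : (L <= N)%N -> (\sum_(1 <= j < N.+1) (j <= L) = L)%N.
Proof.
move=> LN; rewrite (@big_cat_nat _ _ _ L.+1) //=.
rewrite [X in (_ + X)%N]big_nat_cond [X in (_ + X)%N]big1 => [|j /andP[/andP[Lj _] _]]; last first.
  by rewrite leqNgt Lj.
rewrite addn0 big_nat_cond (eq_bigr (fun=> 1%N)) => [|j /andP[/andP[_ jL] _]]; last first.
  by rewrite -ltnS jL.
by rewrite -big_nat_cond sum_nat_const_nat muln1 subn1.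
Qed.

(** The identity log = Lambda * 1: p^j divides k for exactly logn p k values of
    j >= 1. *)
Lemma mangoldt_sum_dvd N k : (0 < k <= N)%N ->
  mangoldt_sum N (fun d => (d %| k)%:R) = lnn k.
Proof.
move=> /andP[k0 kN].
have kE : k = (\prod_(0 <= p < N.+1) p ^ logn p k)%N.
  rewrite -[LHS](partnT k0) (widen_partn _ kN).
  by apply: eq_bigl => p; rewrite inE.
rewrite [in RHS]kE ln_prodn; last first.
  by move=> p _; rewrite expn_gt0; case: p.
rewrite /mangoldt_sum big_mkcond; apply: eq_bigr => p _.
case: ifP => p_pr; last first.
  by rewrite lognE p_pr /= expn0 ln1.
rewrite -mulr_sumr.
have -> : \sum_(1 <= j < N.+1) (p ^ j %| k)%:R = (logn p k)%:R :> R.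
  rewrite -natr_sum; congr (_%:R).
  under eq_bigr => j _ do rewrite pfactor_dvdn //.
  apply: sum_leq; apply: leq_trans kN.
  apply: leq_trans (dvdn_leq k0 (pfactor_dvdnn p k)).
  by apply/ltnW/ltn_expl/prime_gt1.
by rewrite natrX lnXn ?ltr0n ?prime_gt0 // mulr_natr.
Qed.

Lemma sum_dvdn (f : nat -> R) n d : (0 < d)%N ->
  \sum_(1 <= k < n.+1) f k * (d %| k)%:R =
  \sum_(1 <= m < (n %/ d).+1) f (d * m)%N.
Proof.
move=> d0; elim: n => [|n IHn]; first by rewrite div0n !big_geq.
rewrite big_nat_recr //= IHn divnS //; case: (boolP (d %| n.+1)%N) => dn /=.
  rewrite add1n [in RHS]big_nat_recr //= mulr1; congr (_ + f _).
  by rewrite -{1}(divnK dn) divnS // dn mulnC.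
by rewrite mulr0 addr0 add0n.
Qed.

Lemma sum_ln_mangoldt N n : (n <= N)%N ->
  \sum_(1 <= k < n.+1) lnn k = mangoldt_sum N (fun d => (n %/ d)%:R).
Proof.
move=> nN.
rewrite (eq_big_nat _ _ (F2 := fun k => mangoldt_sum N (fun d => (d %| k)%:R))).
  rewrite mangoldt_sum_sum; apply: eq_mangoldt_sum => d d0.
  have := sum_dvdn (fun=> 1) n d0.
  under eq_bigr do rewrite mul1r.
  by move=> ->; rewrite sumr_const_nat subn1.
move=> k /andP[k0 kn]; rewrite mangoldt_sum_dvd // k0 /=.
exact: leq_trans nN.
Qed.

Let ln2_le1 : lnn 2 <= 1.
Proof. by have := @le_ln1Dx R 1; apply; lra. Qed.

(** The logarithm of binomial(2m, m) <= 4^m, with log 2 <= 1. *)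
Let central_ln m :
  \sum_(1 <= k < (2 * m).+1) lnn k - 2 * \sum_(1 <= k < m.+1) lnn k <= 2 * m%:R.
Proof.
elim: m => [|m IHm]; first by rewrite muln0 big_geq // !mulr0 subrr.
have -> : (2 * m.+1).+1 = (2 * m).+3 by lia.
rewrite (big_nat_recr (2 * m).+2) //= (big_nat_recr (2 * m).+1) //= (big_nat_recr m.+1) //=.
have E : lnn (2 * m).+2 = lnn 2 + lnn m.+1.
  by rewrite -lnM ?posrE ?ltr0n // -natrM; congr (ln _%:R); lia.
have L : lnn (2 * m).+1 <= lnn (2 * m).+2.
  by rewrite ler_ln ?posrE ?ltr0n // ler_nat.
rewrite -[X in _ <= _ * X]natr1; move: IHm ln2_le1 L E.
by lra.
Qed.

(** Writing the logarithms of (2m)! and m! as sums of Lambda(d) (n / d), the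
    coefficient 2m / d - 2 (m / d) of Lambda(d) is at least 1 for m < d <= 2m.
    Hence psi(2m) - psi(m) <= 2m, and the bound follows by halving n. *)
Lemma chebyshev_bound N n : (n <= N)%N ->
  mangoldt_sum N (fun d => (d <= n)%:R) <= 4 * n%:R.
Proof.
elim/ltn_ind: n => n IH nN.
have even m : (2 * m <= N)%N -> (m < 2 * m)%N || (m == 0)%N -> (2 * m <= n)%N ->
    mangoldt_sum N (fun d => (d <= 2 * m)%:R) <= 6 * m%:R.
  move=> mN /orP[m2|/eqP->] mn; last first.
    rewrite muln0 mulr0 (@eq_mangoldt_sum _ _ (fun=> 0 * 0)).
      by rewrite mangoldt_sumZ mul0r.
    by move=> d d0; rewrite leqn0 gtn_eqF // mul0r.
  have mn' := leq_trans m2 mn.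
  have C := IH m mn' (leq_trans (ltnW mn') nN).
  have := central_ln m; rewrite !(@sum_ln_mangoldt N) //; last exact: leq_trans (ltnW m2) _.
  rewrite -mulNr -mangoldt_sumZ -mangoldt_sumD => D.
  have : mangoldt_sum N (fun d => (d <= 2 * m)%:R + -1 * (d <= m)%:R) <= 2 * m%:R.
    apply: le_trans D; apply: le_mangoldt_sum => d d0.
    suff : ((d <= 2 * m) + 2 * (m %/ d) <= (2 * m %/ d) + (d <= m))%N.
      by rewrite -(ler_nat R) !natrD; lra.
    have h : (2 * (m %/ d) <= 2 * m %/ d)%N.
      by rewrite leq_divRL // -mulnA leq_mul2l leq_trunc_div.
    have [dm|md] := leqP d m.
      by rewrite (leq_trans dm (ltnW m2)) addnC leq_add2r.
    rewrite (divn_small md) muln0 !addn0.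
    by case: (leqP d (2 * m)) => // d2; rewrite divn_gt0.
  rewrite mangoldt_sumD mangoldt_sumZ; lra.
have nE : n = (odd n + 2 * n./2)%N by lia.
have e2 : (2 * n./2 <= n)%N by lia.
have E := even n./2 (leq_trans e2 nN) _ e2.
have {}E := E ltac:(lia).
case on : (odd n) nE => nE; last first.
  by rewrite nE add0n natrM; apply: (le_trans E); have := ler0n R n./2; lra.
(* For odd n the extra term at d = n is at most log n < n. *)
have n0 : (0 < n <= N)%N by rewrite nN andbT; lia.
have := mangoldt_sum_dvd n0.
have : mangoldt_sum N (fun d => (d <= n)%:R) <=
   mangoldt_sum N (fun d => (d <= 2 * n./2)%:R + (d %| n)%:R).
  apply: le_mangoldt_sum => d d0; rewrite -natrD ler_nat.
  have [dn|] // := leqP d n; have [|dn'] := leqP d (2 * n./2) => //.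
  by rewrite (_ : d = n) ?dvdnn //; lia.
rewrite mangoldt_sumD.
have : lnn n < n%:R by rewrite ln_sublinear // ltr0n; case/andP: n0.
have -> : n%:R = 1 + 2 * (n./2)%:R :> R by rewrite {1}nE natrD natrM.
have := ler0n R n./2.
by move: E; lra.
Qed.

End VonMangoldt.

(** * Mertens' estimate for the character modulo 4 *)
Section MertensChi4.

Variable R : realType.

Local Notation lnn n := (ln (n%:R : R)).
Local Notation chi n := ((chi4 n)%:~R : R).

Let sum_chi_le1 m n : `|\sum_(m <= k < n) chi k| <= 1.
Proof. by rewrite -rmorph_sum -intr_norm /= -[1]/(1%:~R) ler_int sum_chi4_le1. Qed.

Let chi_le1 n : `|chi n| <= 1.
Proof. by rewrite -intr_norm -[1]/(1%:~R) ler_int chi4_le1. Qed.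

Let lnn_ge0 n : 0 <= lnn n.
Proof.
case: n => [|n]; first by rewrite ln0.
by rewrite ln_ge0 // ler1n.
Qed.

Lemma chi4_harmonic_tail m n : (0 < m)%N ->
  `|\sum_(m <= k < n) chi k * k%:R^-1| <= m%:R^-1.
Proof.
move=> m0; rewrite -[X in _ <= X]mul1r.
apply: (@abel_bound R (fun k => chi k) (fun k => k%:R^-1)) => // k mk.
  have k0 := leq_trans m0 mk.
by rewrite lef_pV2 ?posrE ?ltr0n // ?ler_nat //; apply: leq_trans m0 _.
Qed.

(** From log (1/2) <= -1/2. *)
Let lnn4_ge1 : 1 <= lnn 4.
Proof.
have := @le_ln1Dx R (- (2^-1)); have -> : 1 + - (2^-1) = 2^-1 :> R by field.
rewrite lnV ?posrE // => H.
have -> : lnn 4 = ln (2 : R) + ln 2.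
  by rewrite -lnM ?posrE //; congr ln; ring.
have := H ltac:(lra); lra.
Qed.

(** log t / t decreases as soon as log t >= 1. *)
Let ln_over_decr k : (4 <= k)%N -> lnn k.+1 * k.+1%:R^-1 <= lnn k * k%:R^-1.
Proof.
move=> k4; have k0 : 0 < k%:R :> R by rewrite ltr0n; apply: leq_trans k4.
have k1 : 0 < k.+1%:R :> R by rewrite ltr0n.
rewrite ler_pdivrMr // mulrAC ler_pdivlMr //.
have L : lnn k.+1 <= lnn k + k%:R^-1.
  rewrite -lerBlDl -ln_div ?posrE //.
  rewrite (_ : _ / _ = 1 + k%:R^-1); last by rewrite -[k.+1%:R]natr1 mulrDl divff ?gt_eqF // mul1r.
  by apply: le_ln1Dx; have : 0 < k%:R^-1 :> R by [rewrite invr_gt0]; lra.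
have M : 1 <= lnn k.
  by apply: (le_trans lnn4_ge1); rewrite ler_ln ?posrE // ler_nat.
apply: (@le_trans _ _ ((lnn k + k%:R^-1) * k%:R)); first by rewrite ler_wpM2r // ltW.
by rewrite mulrDl mulVf ?gt_eqF // -natr1 mulrDr mulr1 lerD2l.
Qed.

Lemma chi4_ln_sum_bound n :
  `|\sum_(1 <= k < n) chi k * (lnn k * k%:R^-1)| <= 5.
Proof.
have small k : `|chi k * (lnn k * k%:R^-1)| <= 1.
  rewrite normrM mulr_ile1 // ger0_norm ?mulr_ge0 //.
  case: k => [|k]; first by rewrite ln0 // mul0r.
  by rewrite ler_pdivrMr ?ltr0n // mul1r ltW // ln_sublinear // ltr0n.
(* Monotonicity of log k / k only starts at k = 4. *)
have [n4|n4] := leqP n 4.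
  apply: (le_trans (ler_norm_sum _ _ _)).
  apply: (le_trans (ler_sum _ (fun k _ => small k))).
  by rewrite sumr_const_nat (ler_nat R _ 5); lia.
rewrite (@big_cat_nat _ _ _ 4) //=; last exact: ltnW.
apply: (le_trans (ler_normD _ _)); rewrite (_ : 5 = 3 + 2); last by ring.
apply: lerD.
  apply: (le_trans (ler_norm_sum _ _ _)).
  apply: (le_trans (ler_sum _ (fun k _ => small k))).
  by rewrite sumr_const_nat.
have := @abel_bound R (fun k => chi k) (fun k => lnn k * k%:R^-1) 1 4.
move=> /(_ (fun n => sum_chi_le1 4 n) _ ln_over_decr n) H.
apply: (le_trans (H _)); first by move=> k _; rewrite mulr_ge0.
rewrite mul1r; have := ln_sublinear (ltr0n R 4); lra.
Qed.

(** Let L(n) be the partial sums of chi4(k) / k. Expanding log = Lambda * 1 in the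
    bounded sum E of chi4(k) log k / k turns it into the sum of
    Lambda(d) chi4(d) / d L(N / d). Replacing L(N / d) by L(N) costs at most d / N
    in each term, in total psi(N) / N <= 4, so L(N) M is bounded; and
    L(N) >= 1 - 1/2. *)
Lemma mangoldt_chi4_bound N : (0 < N)%N ->
  `|mangoldt_sum N (fun d => (d <= N)%:R * (chi d * d%:R^-1))| <= 18.
Proof.
move=> N0.
pose L n := \sum_(1 <= k < n.+1) chi k * k%:R^-1.
set M := mangoldt_sum N _.
pose E := \sum_(1 <= k < N.+1) chi k * (lnn k * k%:R^-1).
have EE : E = mangoldt_sum N (fun d => chi d * d%:R^-1 * L (N %/ d)%N).
  rewrite /E (eq_big_nat _ _ (F2 := fun k =>
     mangoldt_sum N (fun d => chi k * k%:R^-1 * (d %| k)%:R))); last first.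
    move=> k /andP[k0 kN]; rewrite mangoldt_sumZ mangoldt_sum_dvd ?k0 //.
    by ring.
  rewrite mangoldt_sum_sum; apply: eq_mangoldt_sum => d d0.
  rewrite (sum_dvdn (fun k => chi k * k%:R^-1)) // /L mulr_sumr.
  by apply: eq_bigr => m _; rewrite chi4M rmorphM natrM invfM /=; ring.
have LN : 2^-1 <= L N.
  rewrite /L big_ltn // (_ : chi 1 = 1) // invr1 mulr1.
  have := @chi4_harmonic_tail 2 N.+1 isT; rewrite ler_norml => /andP[+ _].
  lra.
have D : `|L N * M - E| <= 4.
  rewrite EE /M -mangoldt_sumZ -[X in _ - X]mul1r -mulNr -mangoldt_sumZ -mangoldt_sumD.
  apply: (le_trans (norm_mangoldt_sum _ _)).
  have -> : 4 = N%:R^-1 * (4 * N%:R) :> R by field; rewrite pnatr_eq0 -lt0n.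
  apply: le_trans (_ : N%:R^-1 * mangoldt_sum N (fun d => (d <= N)%:R) <= _); last first.
    by rewrite ler_wpM2l ?invr_ge0 // chebyshev_bound.
  rewrite -mangoldt_sumZ; apply: le_mangoldt_sum => d d0.
  have [dN|dN] := leqP d N; last first.
    by rewrite divn_small // {2}/L big_geq // !(mulr0, mul0r) addr0 normr0.
  rewrite mul1r mulr1 (_ : _ + _ = chi d * d%:R^-1 * (L N - L (N %/ d)%N)); last by ring.
  have -> : L N - L (N %/ d)%N = \sum_((N %/ d).+1 <= k < N.+1) chi k * k%:R^-1.
    rewrite /L (@big_cat_nat _ _ _ (N %/ d).+1) //=; last by rewrite ltnS leq_div.
    by rewrite addrAC subrr add0r.
  rewrite -mulrA normrM -[X in _ <= X]mul1r ler_pM //.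
  rewrite normrM ger0_norm ?invr_ge0 //.
  apply: (@le_trans _ _ (d%:R^-1 * (N %/ d).+1%:R^-1)).
    by rewrite ler_wpM2l ?invr_ge0 // chi4_harmonic_tail.
  rewrite -invfM lef_pV2 ?posrE -?natrM ?ltr0n ?muln_gt0 ?d0 //.
  by rewrite ler_nat ltnW // mulnC; apply: ltn_ceil.
have E5 : `|E| <= 5 by apply: chi4_ln_sum_bound.
have LM : `|L N * M| <= 9.
  rewrite -[X in `|X|](subrK E); apply: (le_trans (ler_normD _ _)); lra.
have : 2^-1 * `|M| <= 9.
  apply: le_trans LM; rewrite normrM ler_wpM2r //.
  by apply: le_trans LN _; exact: ler_norm.
lra.
Qed.

(** (log t + 2) / t is nearly a primitive of - log t / t^2, with room to spare. *)
Let ln_sqr_telescope (y : R) : 1 <= y ->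
  ln (y + 1) * ((y + 1) ^- 2) <= (ln y + 2) / y - (ln (y + 1) + 2) / (y + 1).
Proof.
move=> y1; have y0 : 0 < y by lra.
have L : ln (y + 1) <= ln y + y^-1.
  rewrite -lerBlDl -ln_div ?posrE //; last by lra.
  rewrite (_ : _ / _ = 1 + y^-1); last by rewrite mulrDl divff ?gt_eqF // mul1r.
  by apply: le_ln1Dx; apply: (lt_trans (ltrN10 R)); rewrite invr_gt0.
have : 0 <= ln (y + 1) by apply: ln_ge0; lra.
move: (ln (y + 1)) (ln y) L => a b L a0.
apply: (@le_trans _ _ ((a - y^-1 + 2) / y - (a + 2) / (y + 1))); last first.
  rewrite lerD2r; apply: ler_wpM2r; first by rewrite invr_ge0 ltW.
  by rewrite lerD2r lerBlDr.
rewrite -subr_ge0.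
rewrite (_ : _ - _ = (a * y + (y ^+ 2 - 1)) / (y ^+ 2 * (y + 1) ^+ 2)); last first.
  by field; apply/andP; split; rewrite gt_eqF //; lra.
apply: divr_ge0; last by rewrite mulr_ge0 ?sqr_ge0.
apply: addr_ge0; first by rewrite mulr_ge0 // ltW.
by rewrite subr_ge0 -[1](expr1n R 2) ler_pXn2r ?nnegrE // ltW.
Qed.

Let ln_sqr_tail n :
  \sum_(2 <= k < n) lnn k * (k%:R ^- 2) <= 2.
Proof.
pose G (k : nat) : R := (lnn k + 2) / k%:R.
have G0 k : 0 <= G k by rewrite divr_ge0 // addr_ge0.
have [n2|n2] := leqP n 2; first by rewrite big_geq.
apply: (@le_trans _ _ (\sum_(2 <= k < n) (G k.-1 - G k))).
  rewrite !big_nat; apply: ler_sum => -[//|[//|k]] _.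
  by rewrite /G /= -natr1; apply: ln_sqr_telescope; rewrite ler1n.
rewrite (@telescope_sumr_eq _ 2 n (fun k => - G k.-1) _ (ltnW n2)) => [|k _].
  by rewrite opprK {2}/G /= ln1 add0r divr1 gerDr oppr_le0.
by rewrite opprK addrC.
Qed.

(** The prime powers p^j with j >= 2 in the previous sum contribute at most
    twice the sum of log p / p^2, which is at most 4. *)
Lemma mertens_chi4 N :
  `|\sum_(0 <= p < N.+1 | prime p) chi p * (lnn p * p%:R^-1)| <= 22.
Proof.
have [->|] := posnP N.
  by rewrite big_nat_cond big1 ?normr0 // => -[].
move=> N0; have H := mangoldt_chi4_bound N0.
set M := mangoldt_sum _ _ in H; set S := \sum_(_ <= _ < _ | _) _.
suff D : `|M - S| <= 4.
  by rewrite -[S](subKr M); apply: (le_trans (ler_normB _ _)); lra.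
rewrite /M /S /mangoldt_sum -sumrB.
apply: (le_trans (ler_norm_sum _ _ _)).
apply: (@le_trans _ _ (\sum_(0 <= p < N.+1 | prime p) 2 * (lnn p * p%:R ^- 2))).
  rewrite big_nat_cond [X in _ <= X]big_nat_cond.
  apply: ler_sum => p /andP[/andP[_ pN] p_pr].
  rewrite big_ltn // expn1 -ltnS pN mul1r mulrCA.
  rewrite addrAC subrr add0r.
  apply: (le_trans (ler_norm_sum _ _ _)).
  have p0 : 0 < p%:R :> R by rewrite ltr0n prime_gt0.
  apply: (@le_trans _ _ (\sum_(2 <= j < N.+1) lnn p * p%:R^-1 ^+ j)).
    apply: ler_sum => j _; rewrite normrM ger0_norm // ler_wpM2l //.
    rewrite !normrM -[X in _ <= X]mul1r ler_pM ?mulr_ge0 //.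
      by rewrite ger0_norm // lern1 leq_b1.
    have tj : 0 <= p%:R^-1 ^+ j :> R by rewrite exprn_ge0 // invr_ge0.
    by rewrite natrX -exprVn [X in _ * X]ger0_norm // ler_piMl.
  rewrite -mulr_sumr mulrCA ler_wpM2l // -exprVn.
  set t := p%:R^-1; have t0 : 0 < t by rewrite invr_gt0.
  have t2 : 2 * t <= 1 by rewrite ler_pdivrMr // mul1r (ler_nat _ 2) prime_gt1.
  have [N2|N2] := leqP 2 N.+1; last by rewrite big_geq ?(ltnW N2) // mulr_ge0 // exprn_ge0 // ltW.
  suff : \sum_(2 <= j < N.+1) t ^+ j <= 2 * t ^+ 2 - 2 * t ^+ N.+1.
    by have := exprn_ge0 N.+1 (ltW t0); lra.
  elim: N.+1 N2 => // n IHn; rewrite leq_eqVlt => /orP[/eqP<-|n2].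
    by rewrite big_geq // subrr.
  rewrite big_nat_recr //=; have := IHn n2.
  have : 2 * t ^+ n.+1 <= t ^+ n by rewrite exprS mulrA ler_piMl // exprn_ge0 // ltW.
  lra.
rewrite -mulr_sumr (_ : 4 = 2 * 2) ?ler_wpM2l //; last by ring.
apply: le_trans (ln_sqr_tail N.+1).
rewrite big_mkcond [X in _ <= X]big_mkcond /=.
have N2 : (2 <= N.+1)%N by [].
rewrite (@big_cat_nat _ _ _ 2) //= [X in X + _](_ : _ = 0) ?add0r; last first.
  by rewrite 2?big_ltn // big_geq // !addr0.
by apply: ler_sum => p _; case: ifP => // _; rewrite mulr_ge0 // invr_ge0 exprn_ge0.
Qed.

End MertensChi4.

(** * Convergence of the Euler product *)
Section EulerProduct.

Local Open Scope classical_set_scope.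

Variable R : realType.

Local Notation lnn n := (ln (n%:R : R)).
Local Notation chi n := ((chi4 n)%:~R : R).

Let chi_le1 n : `|chi n| <= 1.
Proof. by rewrite -intr_norm -[1]/(1%:~R) ler_int chi4_le1. Qed.

(** Partial summation against the decreasing weight 1 / log p. The constant is
    twice that of mertens_chi4, as the sum starts at m. *)
Lemma chi4_prime_sum_tail m n : (2 <= m)%N ->
  `|\sum_(m <= p < n) (if prime p then chi p * p%:R^-1 else 0)| <= 44 / lnn m.
Proof.
move=> m2.
have ln_gt0 k : (m <= k)%N -> 0 < lnn k.
  by move=> mk; rewrite ln_gt0 // ltr1n; apply: leq_trans mk.
pose u k := if prime k then chi k * (lnn k * k%:R^-1) else 0.
rewrite (eq_big_nat _ _ (F2 := fun k => u k * (lnn k)^-1)); last first.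
  move=> k /andP[mk _]; rewrite /u; case: ifP => _; last by rewrite mul0r.
  by field; rewrite gt_eqF ?ln_gt0 ?pnatr_eq0 //= -lt0n; apply: leq_trans mk; exact: ltnW.
apply: abel_bound => [n'|k mk|k mk].
- have M k : `|\sum_(0 <= p < k) u p| <= 22.
    rewrite -big_mkcond; case: k => [|k]; last exact: mertens_chi4.
    by rewrite big_geq // normr0.
  have [nm|/ltnW mn] := leqP n' m; first by rewrite big_geq // normr0.
  have E : \sum_(m <= k < n') u k = \sum_(0 <= k < n') u k - \sum_(0 <= k < m) u k.
    by rewrite [in RHS](@big_cat_nat _ _ _ m) //= addrAC subrr add0r.
  rewrite E; apply: (le_trans (ler_normB _ _)).
  by have := M n'; have := M m; lra.
- by rewrite invr_ge0 ltW // ln_gt0.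
- have mk1 := leq_trans mk (leqnSn k).
  rewrite lef_pV2 ?posrE ?ln_gt0 // ler_ln ?posrE ?ltr0n ?ler_nat //.
  exact: leq_trans (ltnW m2) mk.
Qed.

(** The lower bound is log (1 + t) >= t / (1 + t), from log (1/(1+t)) <= - t/(1+t). *)
Let ln1D_approx (t : R) : `|t| <= 2^-1 -> `|ln (1 + t) - t| <= 2 * t ^+ 2.
Proof.
rewrite ler_norml => /andP[t1 t2].
have t0 : 0 < 1 + t by lra.
have U : ln (1 + t) <= t by apply: le_ln1Dx; lra.
have L : t / (1 + t) <= ln (1 + t).
  rewrite -[ln _]opprK -lnV ?posrE // lerNr.
  rewrite [X in ln X](_ : _ = 1 + - (t / (1 + t))); last by field; rewrite gt_eqF.
  apply: le_ln1Dx; rewrite ltrN2 ltr_pdivrMr //; lra.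
have E : t / (1 + t) = t - t ^+ 2 / (1 + t) by field; rewrite gt_eqF.
have F : t ^+ 2 / (1 + t) <= 2 * t ^+ 2.
  rewrite ler_pdivrMr // mulrAC -[X in X <= _]mul1r ler_wpM2r ?sqr_ge0 //; lra.
rewrite ler_norml; have := sqr_ge0 t; move: L; rewrite E; lra.
Qed.

Let eps k : R := if prime k then ln (1 - chi k / (k%:R - 1)) else 0.

(** Each log (1 - chi4(p) / (p - 1)) differs from - chi4(p) / p by at most
    3 / ((p - 1)(p - 2)), and these bounds telescope. *)
Let eps_tail m n : (3 <= m)%N ->
  `|\sum_(m <= k < n) eps k| <= 44 / lnn m + 3 / (m%:R - 2).
Proof.
move=> m3.
pose v k : R := if prime k then chi k * k%:R^-1 else 0.
rewrite (eq_bigr (fun k => (eps k + v k) - v k)) => [|k _]; last by rewrite addrK.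
rewrite sumrB; apply: (le_trans (ler_normB _ _)); rewrite addrC lerD //.
  exact/chi4_prime_sum_tail/ltnW.
apply: (le_trans (ler_norm_sum _ _ _)).
have m2 : 0 < m%:R - 2 :> R by rewrite subr_gt0 ltr_nat.
have [nm|/ltnW mn] := leqP n m.
  by rewrite big_geq // divr_ge0 // ltW.
pose G k : R := 3 / (k%:R - 2).
apply: (@le_trans _ _ (\sum_(m <= k < n) (- G k.+1 - - G k))); last first.
  rewrite (@telescope_sumr _ m n (fun k => - G k)) // opprK gerDr.
  rewrite oppr_le0 divr_ge0 // subr_ge0 ler_nat; exact: ltnW (leq_trans m3 mn).
rewrite !big_nat; apply: ler_sum => k /andP[mk _].
have k3 : 3 <= k%:R :> R by rewrite ler_nat; apply: leq_trans mk.
have GE : - G k.+1 - - G k = 3 / ((k%:R - 1) * (k%:R - 2)).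
  rewrite /G -natr1; field; apply/andP; split; rewrite gt_eqF //; lra.
have [k1 k2] : 0 < k%:R - 1 :> R /\ 0 < k%:R - 2 :> R by split; lra.
rewrite {}GE /eps /v; case: ifP => _; last first.
  by rewrite addr0 normr0 divr_ge0 // mulr_ge0 // ltW.
set y : R := k%:R in k3 k1 k2 *.
have {}y0 : 0 < y by lra.
have t2 : `|- (chi k / (y - 1))| <= 2^-1.
  rewrite normrN normrM [`|_^-1|]gtr0_norm ?invr_gt0 //.
  apply: (@le_trans _ _ (1 * (y - 1)^-1)); first by rewrite ler_wpM2r // invr_ge0 ltW.
  by rewrite mul1r lef_pV2 ?posrE //; lra.
have chi2 : chi k ^+ 2 <= 1 by rewrite -real_normK ?num_real // exprn_ile1.
rewrite (_ : _ + _ = (ln (1 + - (chi k / (y - 1))) - - (chi k / (y - 1)))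
   + - (chi k / (y * (y - 1)))); last first.
  by field; apply/andP; split; rewrite gt_eqF.
apply: (le_trans (ler_normD _ _)).
rewrite (_ : 3 / _ = 2 / ((y - 1) * (y - 2)) + 1 / ((y - 1) * (y - 2))); last first.
  by rewrite -mulrDl; congr (_ / _); ring.
have p12 : 0 < (y - 1) * (y - 2) by rewrite mulr_gt0.
apply: lerD.
  apply: (le_trans (ln1D_approx t2)); rewrite sqrrN expr_div_n ler_wpM2l //.
  apply: (@le_trans _ _ (1 / (y - 1) ^+ 2)).
    by rewrite ler_wpM2r // invr_ge0 exprn_ge0 // ltW.
  rewrite mul1r lef_pV2 ?posrE ?exprn_gt0 // expr2 ler_wpM2l ?ltW //; lra.
rewrite normrN normrM ler_pM // normfV gtr0_norm ?mulr_gt0 //.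
rewrite lef_pV2 ?posrE ?mulr_gt0 // mulrC ler_wpM2r ?ltW //; lra.
Qed.

(** The series of logarithms is Cauchy by the tail bound, and the exponential of
    its sum is not 0. *)
Lemma euler_product_cvg m : (3 <= m)%N -> exists2 c : R, c != 0 &
  (fun n => \prod_(m <= p < n | prime p) (1 - chi p / (p%:R - 1)) : R)
    @ \oo --> c.
Proof.
move=> m3.
pose a k := if (m <= k)%N then eps k else 0.
have a_tail j n : (m <= j)%N -> \sum_(j <= k < n) a k = \sum_(j <= k < n) eps k.
  by move=> mj; apply: eq_big_nat => k /andP[jk _]; rewrite /a (leq_trans mj jk).
have cva : cvgn (series a).
  apply/cauchy_cvgP/cauchy_seriesP => e e0.
  (* Beyond r each of the two summands of eps_tail is below e / 2. *)
  pose r := expR (88 / e) + 6 / e + 2 + m%:R.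
  exists ([set k | r < k%:R], setT); first by split=> /=; [exact: nbhs_infty_gtr|exact: filterT].
  move=> [j n] /= [rj _].
  have e1 : 0 < 6 / e by rewrite divr_gt0.
  have e2 := expR_gt0 (88 / e).
  have e3 : 0 <= m%:R :> R by [].
  have mj : (m <= j)%N by rewrite -(ler_nat R); move: rj; rewrite /r; lra.
  rewrite a_tail //; apply: (le_lt_trans (eps_tail n (leq_trans m3 mj))).
  have L : 88 / e < lnn j.
    rewrite -[X in X < _]expRK ltr_ln ?posrE //; last first.
      by rewrite ltr0n (leq_trans _ mj) // (leq_trans _ m3).
    by move: rj; rewrite /r; lra.
  have l0 : 0 < lnn j by apply: lt_trans L; rewrite divr_gt0.
  have j2 : 6 / e < j%:R - 2 by move: rj; rewrite /r; lra.
  have A : 44 / lnn j < e / 2.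
    rewrite ltr_pdivrMr //; move: L; rewrite ltr_pdivrMr //; lra.
  have B : 3 / (j%:R - 2) < e / 2.
    rewrite ltr_pdivrMr; last lra.
    by move: j2; rewrite ltr_pdivrMr //; lra.
  lra.
exists (expR (limn (series a))); first by rewrite gt_eqF // expR_gt0.
rewrite (_ : (fun n => _) = expR \o series a); last first.
  apply/funext => n /=; rewrite /series /=.
  have [nm|/ltnW mn] := leqP n m.
    rewrite big_geq // big_nat_cond big1 ?expR0 // => k /andP[/andP[_ kn] _].
    by rewrite /a leqNgt (leq_trans kn nm).
  rewrite [in RHS](@big_cat_nat _ _ _ m) //= [X in X + _]big_nat_cond.
  rewrite [X in X + _]big1 => [|k /andP[/andP[_ km] _]]; last first.
    by rewrite /a leqNgt km.
  rewrite add0r a_tail // expR_sum big_mkcond !big_nat.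
  apply: eq_bigr => k /andP[mk _]; rewrite /eps.
  case: ifP => _; last by rewrite expR0.
  rewrite lnK // posrE subr_gt0.
  have k3 : 3 <= k%:R :> R by rewrite ler_nat (leq_trans m3).
  rewrite ltr_pdivrMr; last lra.
  have := chi_le1 k; rewrite ler_norml => /andP[_]; lra.
apply: continuous_cvg; last exact: cva.
exact: continuous_expR.
Qed.

End EulerProduct.

(** Up to a square factor this is the symbol of -1. *)
Lemma legendre_neg_square (s : int) p : prime p -> (2 < p)%N ->
  ~~ (p%:Z %| s)%Z -> legendre (- s ^+ 2) p = chi4 p.
Proof.
move=> p_pr p2 ps; have p_odd : odd p by case: (even_prime p_pr) p2 => [->|].
have pF : p \in [pchar 'F_p] by rewrite pchar_Fp.
have s0 : s%:~R != 0 :> 'F_p by rewrite -(dvdz_pcharf pF).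
have sE : (- s ^+ 2)%:~R = - (s%:~R) ^+ 2 :> 'F_p by rewrite rmorphN rmorphXn.
have nd : ~~ (p%:Z %| - s ^+ 2)%Z.
  by rewrite (dvdz_pcharf pF) sE oppr_eq0 expf_eq0.
rewrite /legendre (negPf nd) /chi4 p_odd; congr (if _ then _ else _).
rewrite sE; apply/existsP/eqP => [[x /eqP xE]|p1].
  have : (x / s%:~R) ^+ 2 = -1 by rewrite expr_div_n xE mulNr divff ?expf_neq0.
  move: (x / _) => y y2.
  apply/eqP; apply/negPn/negP => p3.
  have pE : p = (2 * (2 * (p %/ 4)).+1).+1 by move: p_odd p3; clear; lia.
  have y0 : y != 0.
    by apply: contraNneq (oner_neq0 'F_p) => y0; rewrite -oppr_eq0 -y2 y0 expr0n.
  have : y ^+ (2 * (2 * (p %/ 4)).+1) = 1.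
    apply: (mulfI y0); rewrite -exprS -pE mulr1.
    by rewrite -[X in _ ^+ X](card_Fp p_pr) expf_card.
  rewrite exprM y2 exprS exprM sqrrN !expr1n mulr1 => /eqP.
  rewrite -subr_eq0 -opprD oppr_eq0 -[1 + 1]/(2%:R) -(dvdn_pcharf pF) => /dvdn_leq.
  by move: p2; clear; lia.
have [g g_prim] := exists_primitive_element 'F_p.
have cF : #|'F_p| = (4 * (p %/ 4)).+1 by rewrite card_Fp //; move: p1; clear; lia.
exists (s%:~R * g ^+ (p %/ 4)); rewrite exprMn -exprM mulnC.
by rewrite -(neg1_prim g_prim cF) mulrN1.
Qed.

(** * The Hardy-Littlewood constant is nonzero *)
Section HardyLittlewoodConstant.

Local Open Scope classical_set_scope.

Variable R : realType.

Let factor_gt0 (t : int) p : (2 < p)%N -> `|t| <= 1 ->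
  1 - t%:~R / (p%:R - 1) != 0 :> R.
Proof.
move=> p2 t1; have p3 : 3 <= p%:R :> R by rewrite ler_nat.
rewrite gt_eqF // subr_gt0 ltr_pdivrMr; last lra.
have : t%:~R <= 1 :> R by rewrite -[1]/(1%:~R) ler_int; move: t1; clear; lia.
lra.
Qed.

Lemma legendre_le1 a p : `|legendre a p| <= 1.
Proof. by rewrite /legendre; case: ifP => // _; case: ifP. Qed.

(** Beyond the primes dividing a s the factors are those of the Euler product of
    chi4; the finitely many other factors are nonzero as p >= 3. *)
Lemma HL_delta_neq0 (a b c s : int) : 0 < a -> s != 0 ->
  disc a b c = - s ^+ 2 -> HL_delta R a b c != 0.
Proof.
move=> a0 s0 ds; rewrite /HL_delta !mulf_neq0 //.
- by rewrite intr_eq0 gcdz_eq0.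
- by rewrite invr_eq0 gt_eqF // sqrtr_gt0 ltr0z.
- rewrite prodf_seq_neq0; apply/allP => p _; apply/implyP => /andP[_ p2].
  have p3 : 3 <= p%:R :> R by rewrite ler_nat.
  by rewrite mulf_neq0 ?invr_eq0 // gt_eqF //; lra.
(* No prime p >= K divides a or s. *)
pose K := (3 + `|a| + `|s|)%N.
have K3 : (3 <= K)%N by rewrite /K; clear; lia.
have ndvd n p : (`|n| < p)%N -> n != 0 -> ~~ (p%:Z %| n)%Z.
  move=> np n0; rewrite dvdzE; apply/negP => /dvdn_leq; rewrite absz_gt0.
  by move=> /(_ n0); move: np; clear; lia.
have [x x0 cvx] := @euler_product_cvg R K K3.
pose u := HL_partial_product R a b c K.
have u0 : u != 0.
  rewrite /u /HL_partial_product prodf_seq_neq0; apply/allP => p _.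
  by apply/implyP => /and3P[_ p2 _]; rewrite factor_gt0 ?legendre_le1.
suff -> : limn (HL_partial_product R a b c) = u * x by rewrite mulf_neq0.
apply/cvg_lim => //.
have E n : (K <= n)%N -> HL_partial_product R a b c n =
    u * \prod_(K <= p < n | prime p) (1 - (chi4 p)%:~R / (p%:R - 1)).
  move=> Kn; rewrite /HL_partial_product (@big_cat_nat _ _ _ K) //=; congr (_ * _).
  rewrite big_nat_cond [RHS]big_nat_cond; apply: eq_big => p.
    apply/idP/idP => [/andP[-> /and3P[-> _ _]] //|/andP[/andP[Kp ->] p_pr]].
    rewrite Kp p_pr (leq_trans K3 Kp) ndvd ?gt_eqF //.
    by move: Kp; rewrite /K; clear; lia.
  move=> /andP[/andP[Kp _] /and3P[p_pr p2 _]].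
  rewrite ds legendre_neg_square // ndvd //.
  by move: Kp; rewrite /K; clear; lia.
have : (fun n => u * \prod_(K <= p < n | prime p)
    (1 - (chi4 p)%:~R / (p%:R - 1)) : R) @ \oo --> u * x by apply: cvgMl_tmp.
apply: cvg_trans; apply: near_eq_cvg; near=> n; apply/esym/E.
by near: n; exact: nbhs_infty_ge.
Unshelve. all: end_near.
Qed.

End HardyLittlewoodConstant.

(** * Ratios of asymptotically equal counts *)
Section PrimeRatio.

Local Open Scope classical_set_scope.

Variable R : realType.

Let ln_le_root (x : R) : 1 <= x -> ln x <= 4 * Num.sqrt (Num.sqrt x).
Proof.
move=> x1; have x0 : 0 < x by apply: lt_le_trans x1.
set y := Num.sqrt (Num.sqrt x).
have y0 : 0 < y by rewrite !sqrtr_gt0.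
have -> : x = y ^+ 4.
  by rewrite (exprM y 2 2) !sqr_sqrtr ?sqrtr_ge0 // ltW.
by rewrite lnXn // -[ln y *+ 4]mulr_natl ler_wpM2l // ltW // ln_sublinear.
Qed.

(** This shows that boundedly many exceptional primes do not affect densities. *)
Lemma inv_sqrt_div_ln_cvg0 :
  (fun n : nat => (Num.sqrt n%:R / ln n%:R : R)^-1) @ \oo --> 0.
Proof.
apply/cvgr0Pnorm_le => e e0; near=> n.
have n1 : 1 <= n%:R :> R by rewrite ler1n; near: n; exact: nbhs_infty_gt.
have n0 : 0 < n%:R :> R by apply: lt_le_trans n1.
have H : (4 / e) ^+ 4 <= n%:R by near: n; exact: nbhs_infty_ger.
set y := Num.sqrt (Num.sqrt (n%:R : R)).
have y0 : 0 < y by rewrite !sqrtr_gt0.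
have y2 : y ^+ 2 = Num.sqrt n%:R by rewrite sqr_sqrtr // sqrtr_ge0.
have y4 : y ^+ 4 = n%:R by rewrite (exprM y 2 2) y2 sqr_sqrtr // ltW.
have ye : 4 / e <= y.
  have e4 : 0 <= 4 / e by rewrite divr_ge0 // ltW.
  by rewrite -(@ler_pXn2r _ 4) ?nnegrE ?y4 // ltW.
rewrite invfM invrK mulrC ger0_norm; last first.
  by rewrite mulr_ge0 ?ln_ge0 // invr_ge0 sqrtr_ge0.
rewrite -y2 ler_pdivrMr ?exprn_gt0 //.
apply: (le_trans (ln_le_root n1)); rewrite -/y expr2 mulrA.
apply: ler_wpM2r; first exact: ltW.
by move: ye; rewrite ler_pdivrMr // mulrC.
Unshelve. all: end_near.
Qed.

Let equiv_cvg1 (f h : nat -> R) : (\forall n \near \oo, h n != 0) ->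
  f ~_(\oo) h -> (fun n => f n / h n) @ \oo --> (1 : R).
Proof.
move=> h0 /eqaddoP H; apply/cvgrPdist_le => e e0.
have := H e e0; apply: filterS2 h0 => n h0 /=.
rewrite distrC -[1](divff h0) -mulrBl normrM normfV ler_pdivrMr ?normr_gt0 //.
Qed.

Lemma ratio_cvg (I : finType) (P : I -> nat -> nat) (delta : R)
    (A S : {set I}) (e : nat -> nat) :
  delta != 0 -> S \subset A -> (0 < #|A|)%N -> (forall n, (e n <= 2)%N) ->
  (forall i, i \in A -> (fun n => (P i n)%:R : R) ~_(\oo)
     (fun n => delta * (Num.sqrt n%:R / ln n%:R))) ->
  (fun n => (\sum_(i in S) P i n.+1)%N%:R / (\sum_(i in A) P i n.+1 + e n)%N%:R : R)
    @ \oo --> (#|S|%:R / #|A|%:R : R).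
Proof.
move=> d0 SA A0 e2 PA.
pose h n : R := delta * (Num.sqrt n%:R / ln n%:R).
have h0 : \forall n \near \oo, h n != 0.
  near=> n; have n1 : 1 < n%:R :> R by rewrite ltr1n; near: n; exact: nbhs_infty_gt.
  by rewrite mulf_neq0 // mulf_neq0 ?invr_eq0 // gt_eqF ?ln_gt0 // sqrtr_gt0; lra.
have sum_cvg (B : {set I}) : B \subset A ->
    (fun n => \sum_(i in B) (P i n)%:R / h n) @ \oo --> (#|B|%:R : R).
  move=> BA; rewrite -sumr_const.
  apply: (@cvg_big R I +%R 0 (fun i => i \in B) (@add_continuous R) nat \oo
    (index_enum I) (fun i n => (P i n)%:R / h n) (fun=> 1)) => i iB.
  by apply: equiv_cvg1 => //; apply: PA; apply: (fintype.subsetP BA).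
have eh : (fun n => (e n.-1)%:R / h n) @ \oo --> (0 : R).
  apply/cvgr0Pnorm_le => eps eps0.
  have d1 : 0 < eps * `|delta| / 2 by rewrite divr_gt0 // mulr_gt0 // normr_gt0.
  have /cvgr0Pnorm_le/(_ _ d1) := inv_sqrt_div_ln_cvg0.
  apply: filterS => n H; rewrite normrM /h invfM [`|_ * _^-1|]normrM normfV.
  rewrite ger0_norm //.
  have D : 0 < `|delta| by rewrite normr_gt0.
  apply: (@le_trans _ _ (2 * (`|delta|^-1 * (eps * `|delta| / 2)))).
    by apply: ler_pM; rewrite ?mulr_ge0 ?invr_ge0 ?(ler_nat _ _ 2) // ler_wpM2l ?invr_ge0.
  by rewrite le_eqVlt; apply/orP; left; apply/eqP; field; rewrite normr_eq0.
pose r n : R := (\sum_(i in S) P i n)%N%:R / (\sum_(i in A) P i n + e n.-1)%N%:R.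
suff rl : r @ \oo --> (#|S|%:R / #|A|%:R : R) by move: rl; rewrite -cvg_shiftS.
have L : (fun n => (\sum_(i in S) (P i n)%:R / h n) /
    (\sum_(i in A) (P i n)%:R / h n + (e n.-1)%:R / h n)) @ \oo --> (#|S|%:R / #|A|%:R : R).
  apply: cvgM; first exact: sum_cvg.
  apply: cvgV; first by rewrite pnatr_eq0 -lt0n.
  by rewrite -[X in _ --> X]addr0; apply: cvgD => //; exact: sum_cvg.
apply: cvg_trans L; apply: near_eq_cvg; apply: filterS h0 => n hn.
rewrite /r -!mulr_suml -mulrDl !natrD !natr_sum.
by rewrite invf_div mulrA divfK.
Unshelve. all: end_near.
Qed.

End PrimeRatio.

(** * Primes alpha^2 + x^2 with x in a residue class *)
Section ResidueClasses.

Variables (l : nat) (alpha : int).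
Hypothesis l_prime : prime l.
Hypothesis l_odd : odd l.
Hypothesis alpha_odd : ~~ (2 %| alpha)%Z.

(** The index (c, s) stands for x = c mod l and x = 2s mod 4. Odd x are left out:
    then alpha^2 + x^2 is even. *)
Definition class_member (i : 'I_l * bool) (x : nat) : bool :=
  (x %% l == i.1)%N && (x %% 4 == 2 * i.2)%N.

Definition prime_in_class (i : 'I_l * bool) (p : nat) : bool :=
  prime p && `[< exists2 x : nat, p%:Z = alpha ^+ 2 + x%:Z ^+ 2
                                 & class_member i x >].

Definition class_count (i : 'I_l * bool) (n : nat) : nat :=
  count (prime_in_class i) (iota 0 n).

Definition class_rep (i : 'I_l * bool) : nat :=
  (chinese l 4 i.1 (2 * i.2) %% (l * 4))%N.

Let co_l4 : coprime l 4.
Proof. by rewrite (@coprime_pexpr 2 l 2) // coprimen2. Qed.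

Lemma class_rep_mod i : class_member i (class_rep i).
Proof.
rewrite /class_member /class_rep; apply/andP; split.
  rewrite modn_dvdm ?dvdn_mulr // chinese_modl // modn_small //.
rewrite modn_dvdm ?dvdn_mull // chinese_modr // modn_small //.
by case: i.2.
Qed.

Lemma class_memberE i x :
  class_member i x <-> exists y, x = (y * (l * 4) + class_rep i)%N.
Proof.
have /andP[/eqP r1 /eqP r2] := class_rep_mod i.
split=> [/andP[/eqP x1 /eqP x2]|[y ->]].
  exists (x %/ (l * 4))%N; rewrite {1}(divn_eq x (l * 4)); congr addn.
  have : (x == class_rep i %[mod l * 4])%N.
    by rewrite chinese_remainder // x1 x2 r1 r2 !eqxx.
  by move=> /eqP ->; rewrite /class_rep modn_mod.
rewrite /class_member mulnA modnMDl r2 eqxx andbT.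
by rewrite mulnAC modnMDl r1.
Qed.

(** Substituting x = 4l y + r turns alpha^2 + x^2 into a quadratic polynomial in
    y >= 0, to which the conjecture applies. *)
Lemma class_countE i n : class_count i n =
  prime_values ((l * 4)%:Z ^+ 2) (2 * (l * 4)%:Z * (class_rep i)%:Z)
    ((class_rep i)%:Z ^+ 2 + alpha ^+ 2) n.
Proof.
apply: eq_count => p; rewrite /prime_in_class; congr (_ && _).
apply: asbool_equiv_eq; split=> [[x pE /class_memberE[y xE]]|[y pE]].
  by exists y; rewrite pE xE PoszD PoszM; ring.
exists (y * (l * 4) + class_rep i)%N; last by apply/class_memberE; exists y.
by rewrite pE PoszD PoszM; ring.
Qed.

Lemma dvdz_norm_mod (x : nat) :
  (l%:Z %| alpha ^+ 2 + x%:Z ^+ 2)%Z = ~~ admissible l alpha (x %% l).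
Proof.
rewrite /admissible negbK [in LHS](divn_eq x l) PoszD PoszM.
set q := (x %/ l)%:Z; set c := (x %% l)%:Z.
rewrite (_ : alpha ^+ 2 + (q * l%:Z + _) ^+ 2 =
  (alpha ^+ 2 + c ^+ 2) + (q * q * l%:Z + 2 * q * c) * l%:Z); last by ring.
have h : (l%:Z %| (q * q * l%:Z + 2 * q * c) * l%:Z)%Z by apply: dvdz_mull.
by rewrite rpredDr.
Qed.

Lemma norm_parity (x : int) : (2 %| alpha ^+ 2 + x ^+ 2)%Z = ~~ (2 %| x)%Z.
Proof.
have [a aE] : exists a : int, alpha = a * 2 + 1.
  by exists (alpha %/ 2)%Z; move: alpha_odd; clear; lia.
have -> : (2 %| x)%Z = (2 %| x ^+ 2)%Z.
  by rewrite !dvdzE abszX Euclid_dvdX // andbT.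
rewrite aE (_ : (a * 2 + 1) ^+ 2 = 2 * (2 * a ^+ 2 + 2 * a) + 1); last by ring.
by move: (x ^+ 2) (2 * a ^+ 2 + 2 * a); clear; lia.
Qed.

Lemma class_rep_odd_norm i : ~~ (2 %| (class_rep i)%:Z ^+ 2 + alpha ^+ 2)%Z.
Proof.
have /andP[_ /eqP r2] := class_rep_mod i; rewrite addrC norm_parity negbK.
by move: (class_rep i) r2; case: i.2; clear; lia.
Qed.

Lemma class_rep_norm_mod i :
  (l%:Z %| (class_rep i)%:Z ^+ 2 + alpha ^+ 2)%Z = ~~ admissible l alpha i.1.
Proof.
by have /andP[/eqP r1 _] := class_rep_mod i; rewrite addrC dvdz_norm_mod r1.
Qed.

End ResidueClasses.

Lemma class_disc (M alpha r : int) :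
  disc (M ^+ 2) (2 * M * r) (r ^+ 2 + alpha ^+ 2) = - (2 * M * alpha) ^+ 2.
Proof. by rewrite /disc; ring. Qed.

(** The constant depends on r only through gcd (2, a + b), the primes dividing both
    a and b, and the discriminant; here every prime divisor of a = M^2, in
    particular 2, divides b = 2 M r. *)
Lemma HL_delta_class (R : realType) (M alpha r : int) : (2 %| M)%Z ->
  HL_delta R (M ^+ 2) (2 * M * r) (r ^+ 2 + alpha ^+ 2) =
  HL_delta R (M ^+ 2) 0 (alpha ^+ 2).
Proof.
move=> M2; rewrite /HL_delta; congr (_ / _ * _ * _).
- have h (b : int) : (2 %| b)%Z -> gcdz 2 (M ^+ 2 + b) = 2.
    move=> b2; have : (2 %| M ^+ 2 + b)%Z by rewrite rpredD // expr2 dvdz_mulr.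
    by rewrite dvdzE => /gcdn_idPl; rewrite /gcdz => ->.
  by rewrite !h // -mulrA dvdz_mulr.
- rewrite [LHS]big_seq_cond [RHS]big_seq_cond; apply: eq_bigl => p; apply: andb_id2l.
  rewrite mem_primes abszX => /and3P[p_pr _].
  rewrite Euclid_dvdX // => /andP[pM _].
  have pr : (p%:Z %| 2 * M * r)%Z by apply: dvdz_mulr; apply: dvdz_mull.
  by rewrite pr dvdz0.
- have E a b c b' c' : disc a b c = disc a b' c' ->
      HL_partial_product R a b c = HL_partial_product R a b' c'.
    by move=> e; rewrite /HL_partial_product e.
  have d0 : disc (M ^+ 2) 0 (alpha ^+ 2) = - (2 * M * alpha) ^+ 2.
    by rewrite /disc; ring.
  by rewrite (E _ _ _ _ _ (etrans (class_disc M alpha r) (esym d0))).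
Qed.

Section ClassAsymptotics.

Local Open Scope classical_set_scope.

Variables (R : realType) (l : nat) (alpha : int).
Hypothesis l_prime : prime l.
Hypothesis l_odd : odd l.
Hypothesis alpha_odd : ~~ (2 %| alpha)%Z.

Local Notation M := (Posz (l * 4)).

Let M_gt0 : 0 < M.
Proof. by rewrite ltz_nat muln_gt0 prime_gt0. Qed.

Let alpha0 : alpha != 0.
Proof. by apply: contraNneq alpha_odd => ->; rewrite dvdz0. Qed.

Let M2alpha : 2 * M * alpha != 0.
Proof. by rewrite !mulf_neq0 // gt_eqF. Qed.

(** By HL_delta_class, the common constant of all classes modulo M. *)
Definition class_delta : R := HL_delta R (M ^+ 2) 0 (alpha ^+ 2).

Lemma class_delta_neq0 : class_delta != 0.
Proof.
apply: (@HL_delta_neq0 _ _ _ _ (2 * M * alpha)); rewrite ?exprn_gt0 //.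
by rewrite /disc; ring.
Qed.

Lemma class_equiv (HL : HardyLittlewood R) (i : 'I_l * bool) :
  admissible l alpha i.1 ->
  (fun n => (class_count alpha i n)%:R : R) ~_(\oo)
  (fun n => class_delta * (Num.sqrt n%:R / ln n%:R)).
Proof.
move=> adm; set r := (class_rep i)%:Z.
have := HL (M ^+ 2) (2 * M * r) (r ^+ 2 + alpha ^+ 2).
rewrite HL_delta_class -/class_delta => [H|]; last by rewrite dvdzE /= dvdn_mull.
have -> : (fun n => (class_count alpha i n)%:R : R) =
   (fun n => (prime_values (M ^+ 2) (2 * M * r) (r ^+ 2 + alpha ^+ 2) n)%:R).
  by apply/funext => n; rewrite class_countE.
have codd : ~~ (2 %| r ^+ 2 + alpha ^+ 2)%Z by apply: class_rep_odd_norm.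
apply: H; first by rewrite exprn_gt0.
- have co : coprimez M (r ^+ 2 + alpha ^+ 2).
    rewrite PoszM coprimezMl; apply/andP; split.
      rewrite coprimezE /= prime_coprime // -[X in ~~ X]/(l%:Z %| r ^+ 2 + alpha ^+ 2)%Z.
      by rewrite class_rep_norm_mod // negbK.
    rewrite (_ : 4%:Z = 2 ^+ 2) // coprimez_pexpl //.
    by rewrite coprimezE /= prime_coprime.
  have /eqP g1 : coprimez (M ^+ 2) (r ^+ 2 + alpha ^+ 2) by apply: coprimezXl.
  by rewrite gcdzCA [gcdz (M ^+ 2) _]g1 gcdz1.
- by rewrite negb_and codd orbT.
- move=> [k]; rewrite class_disc => /eqP; rewrite eq_sym -addr_eq0.
  rewrite paddr_eq0 ?sqr_ge0 // => /andP[_]; rewrite sqrf_eq0.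
  by rewrite (negPf M2alpha).
Qed.

End ClassAsymptotics.

(** The hypothesis says that the predicates P i, for i in S, are mutually exclusive
    with disjunction Q. *)
Lemma sum_count_exclusive (T : Type) (I : finType) (S : {set I})
    (P : I -> pred T) (Q : pred T) (s : seq T) :
  (forall p, (\sum_(i in S) P i p = Q p)%N) ->
  (\sum_(i in S) count (P i) s = count Q s)%N.
Proof.
move=> PQ; elim: s => [|x s IHs]; first by rewrite big1.
by rewrite /= -IHs -PQ -big_split.
Qed.

Definition unramified (l p : nat) : bool := ~~ (p%:Z %| 2 * l%:Z)%Z.

Section ClassSums.

Variables (l : nat) (alpha r : int).
Hypothesis l_prime : prime l.
Hypothesis l_odd : odd l.
Hypothesis alpha_odd : ~~ (2 %| alpha)%Z.
Hypothesis r_alpha : r ^+ 2 = alpha ^+ 2.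

Let two_square_prime (p : nat) : bool :=
  prime p && `[< exists x : int, p%:Z = r ^+ 2 + x ^+ 2 >].

Lemma unramifiedE p : prime p -> unramified l p = (p != 2%N) && (p != l).
Proof.
move=> p_pr; rewrite /unramified dvdzE abszM Euclid_dvdM // !dvdn_prime2 //.
by rewrite negb_or.
Qed.

Lemma prime_in_class_exists p : two_square_prime p -> unramified l p ->
  exists2 i : 'I_l * bool, admissible l alpha i.1 & prime_in_class alpha i p.
Proof.
move=> /andP[p_pr /asboolP[x pE]]; rewrite unramifiedE // => /andP[p2 pl].
pose X := `|x|%N.
have {}pE : p%:Z = alpha ^+ 2 + X%:Z ^+ 2 by rewrite pE r_alpha abszE real_normK ?num_real.
have X_even : (2 %| X%:Z)%Z.
  rewrite -[(2 %| X%:Z)%Z]negbK -(norm_parity alpha_odd) -pE dvdzE /= dvdn_prime2 //.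
  by rewrite eq_sym.
pose i : 'I_l * bool := (Ordinal (ltn_pmod X (prime_gt0 l_prime)), (X %% 4 == 2)%N).
exists i => /=.
  by rewrite -[admissible _ _ _]negbK -dvdz_norm_mod -pE dvdzE /= dvdn_prime2 // eq_sym.
rewrite /prime_in_class p_pr; apply/asboolP; exists X => //.
rewrite /class_member /= eqxx /=.
by move: X_even; clear; lia.
Qed.

Lemma prime_in_class_sound (i : 'I_l * bool) p :
  admissible l alpha i.1 -> prime_in_class alpha i p ->
  two_square_prime p /\ unramified l p.
Proof.
move=> adm /andP[p_pr /asboolP[x pE /andP[/eqP x1 /eqP x2]]]; split.
  by rewrite /two_square_prime p_pr; apply/asboolP; exists x%:Z; rewrite r_alpha.
rewrite unramifiedE //; apply/andP; split; apply/eqP => e.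
  have := norm_parity alpha_odd x%:Z; rewrite -pE e dvdzz => /esym.
  by move: x2; case: i.2; clear; lia.
by have := dvdz_norm_mod l alpha x; rewrite -pE e dvdzz x1 adm.
Qed.

Lemma prime_in_class_inj (i j : 'I_l * bool) p :
  prime_in_class alpha i p -> prime_in_class alpha j p -> i = j.
Proof.
move=> /andP[_ /asboolP[x pE /andP[/eqP x1 /eqP x2]]].
move=> /andP[_ /asboolP[y pE' /andP[/eqP y1 /eqP y2]]].
have xy : x = y.
  have /eqP : (x%:Z) ^+ 2 = (y%:Z) ^+ 2 by apply: (addrI (alpha ^+ 2)); rewrite -pE.
  by rewrite eqf_sqr; clear; lia.
rewrite -{}xy in y1 y2.
case: i j x1 x2 y1 y2 => [i s] [j t] /= x1 x2 y1 y2; congr pair.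
  by apply: val_inj; rewrite /= -x1.
by move: y2; rewrite x2; case: (s); case: (t).
Qed.

(** Every prime alpha^2 + x^2 prime to 2l lies in exactly one admissible class, so
    a property of such primes that depends only on the class can be counted
    class by class. *)
Lemma class_sumE (good : pred ('I_l * bool)) (test : pred nat) n :
  (forall (i : 'I_l * bool) p, admissible l alpha i.1 -> prime_in_class alpha i p ->
     unramified l p -> test p = good i) ->
  (\sum_(i in [set i : 'I_l * bool | admissible l alpha i.1 & good i]) class_count alpha i n =
   count (fun p => [&& two_square_prime p, unramified l p & test p]) (iota 0 n))%N.
Proof.
move=> tg; apply: sum_count_exclusive => p; set S := [set i | _].
have [[i adm ip]|none] := pselect (exists2 i : 'I_l * bool, admissible l alpha i.1 &
    prime_in_class alpha i p).
  have [Qp up] := prime_in_class_sound adm ip.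
  rewrite Qp up /= (tg i p) //.
  have others j : j != i -> prime_in_class alpha j p = false.
    by move=> /negP ji; apply/negP => jp; apply: ji; apply/eqP/(prime_in_class_inj jp).
  case gi : (good i); last first.
    apply: big1 => j; rewrite inE => /andP[_ gj]; rewrite others //.
    by apply: contraTneq gj => ->; rewrite gi.
  by rewrite (bigD1 i) ?inE ?adm ?gi //= ip big1 // => j /andP[_ /others ->].
rewrite big1 => [|j]; last first.
  rewrite inE => /andP[adm _]; case jp : (prime_in_class alpha j p) => //.
  by case: none; exists j.
apply/esym/eqP; rewrite eqb0; apply/negP => /and3P[Qp up _].
by apply: none; apply: prime_in_class_exists.
Qed.

Lemma dens_seq_classes (R : realType) (good : pred ('I_l * bool)) N :
  (forall (i : 'I_l * bool) p, admissible l alpha i.1 -> prime_in_class alpha i p ->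
     unramified l p -> (ap l%:Z p == 2 * r) = good i) ->
  dens_seq R l%:Z r N =
  (\sum_(i in [set i : 'I_l * bool | admissible l alpha i.1 & good i])
      class_count alpha i N.+1)%N%:R /
  (\sum_(i in [set i : 'I_l * bool | admissible l alpha i.1]) class_count alpha i N.+1 +
    count (predC (unramified l)) (Q r N))%N%:R.
Proof.
move=> tg; rewrite /dens_seq; congr (_%:R / _%:R).
  rewrite (class_sumE _ tg) /Q count_filter; apply: eq_count => p /=.
  by rewrite andbC.
rewrite -(count_predC (unramified l)); congr addn.
have -> : [set i : 'I_l * bool | admissible l alpha i.1] =
    [set i : 'I_l * bool | admissible l alpha i.1 & predT i].
  by apply/setP => i; rewrite !inE andbT.
rewrite (@class_sumE _ predT) // /Q count_filter; apply: eq_count => p /=.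
by rewrite andbT andbC.
Qed.

Lemma count_ramified N : (count (predC (unramified l)) (Q r N) <= 2)%N.
Proof.
rewrite -size_filter; apply: (@uniq_leq_size _ _ [:: 2; l]).
  by rewrite !filter_uniq ?iota_uniq.
move=> p; rewrite !mem_filter /= => /andP[+ /andP[/andP[p_pr _] _]].
by rewrite unramifiedE // negb_and !negbK !inE.
Qed.

End ClassSums.

(** * Densities as proportions of residue classes *)
Section QuarticDensity.

Variables (l k : nat) (alpha : int) (K : closedFieldType) (im : K).
Hypothesis l_prime : prime l.
Hypothesis lE : l = (4 * k).+1 \/ l.+1 = (4 * k)%N.
Hypothesis alpha_mod4 : (alpha = 1 %[mod 4])%Z.
Hypothesis alpha_l : ~~ (l%:Z %| alpha)%Z.
Hypothesis lK : l \in [pchar K].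
Hypothesis sqr_im : im ^+ 2 = -1.

Let l_odd : odd l.
Proof. by case: lE; move: l_prime; case: (l) => // n _; clear; lia. Qed.

Let alpha_odd : ~~ (2 %| alpha)%Z.
Proof. by move: alpha_mod4; clear; lia. Qed.

Definition quartic_test (e : bool) (c : nat) : bool :=
  gintC im alpha c%:Z ^+ k == (-1) ^+ e * gint im alpha c%:Z ^+ k.

(** The class decides the event a_p(E_l) = 2 (-1)^e alpha. For l = 3 mod 4 the
    factor (-1)^((p-1)/4) of quartic reciprocity enters through s, as p = 1 mod 8
    iff 4 | x. *)
Definition class_good (e : bool) (i : 'I_l * bool) : bool :=
  quartic_test (e (+) ((l %% 4 == 3)%N && i.2)) i.1.

Lemma ap_class (e : bool) (i : 'I_l * bool) p :
  prime_in_class alpha i p -> unramified l p ->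
  (ap l%:Z p == 2 * ((-1) ^+ e * alpha)) = class_good e i.
Proof.
move=> /andP[p_pr /asboolP[x pE /andP[/eqP x1 /eqP x2]]] nd.
have pl : p != l by move: nd; rewrite (unramifiedE l_prime) // => /andP[].
have [g g_prim] := exists_primitive_element 'F_p.
have x_even : (2 %| x%:Z)%Z by move: x2; case: i.2; clear; lia.
have l0 : l%:R != 0 :> 'F_p.
  by rewrite -(dvdn_pcharf (pchar_Fp p_pr)) dvdn_prime2.
have [kappa lk] := prim_powP g_prim l0.
have lk' : (l%:Z)%:~R = g ^+ kappa :> 'F_p by rewrite -lk -natz mulrz_nat.
rewrite (ap_eq_twice p_pr g_prim pE alpha_mod4 x_even e lk').
have xc : x%:Z%:~R = (i.1 : nat)%:Z%:~R :> K.
  rewrite -x1 {1}(divn_eq x l) PoszD PoszM rmorphD rmorphM /=.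
  have -> : (l%:Z)%:~R = 0 :> K.
    by rewrite -[_%:~R]/(l%:R) (pcharf0 lK).
  by rewrite mulr0 add0r.
have R1 := quartic_reciprocity_1mod4 lK l_odd p_pr pl g_prim pE alpha_mod4 x_even sqr_im.
have R3 := quartic_reciprocity_3mod4 lK l_odd p_pr pl g_prim pE alpha_mod4 x_even sqr_im.
rewrite /class_good /quartic_test /gint /gintC -xc.
case: lE => h.
  have -> : (l %% 4 == 3)%N = false by rewrite h; clear; lia.
  by rewrite addbF -(R1 _ _ e h lk).
have -> : (l %% 4 == 3)%N by move: h; clear; lia.
have -> : i.2 = ~~ (4 %| x%:Z)%Z by move: x2; case: i.2; clear; lia.
by rewrite -(R3 _ _ e h lk).
Qed.

Let card_pairs (T : 'I_l -> bool -> bool) :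
  #|[set i : 'I_l * bool | T i.1 i.2]| =
  (#|[set c | T c true]| + #|[set c | T c false]|)%N.
Proof.
rewrite -!sum1dep_card -(pair_big_dep predT T (fun _ _ => 1%N)) /=.
rewrite [in RHS]big_mkcond [X in (_ + X)%N]big_mkcond -big_split /=.
by apply: eq_bigr => c _; rewrite big_mkcond big_bool.
Qed.

Let adm := [set i : 'I_l * bool | admissible l alpha i.1].

Lemma card_adm_classes : (#|adm| + 2 = 8 * k)%N.
Proof.
rewrite /adm (card_pairs (fun c _ => admissible l alpha c)) /=.
rewrite -[(8 * k)%N](mulnA 2 4 k) -(card_admissible lK l_odd alpha_l sqr_im lE).
by rewrite mulnS addnC mul2n addnn.
Qed.

(** For l = 3 mod 4 the two values of s ask for opposite signs of (z'/z)^k, so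
    exactly one of them meets the missing root -1; this is why the densities at
    2 alpha and -2 alpha then agree. *)
Lemma card_good_classes (e : bool) :
  #|[set i : 'I_l * bool | admissible l alpha i.1 & class_good e i]| =
  (if (l %% 4 == 3)%N then 2 * k - 1 else 2 * (k - (odd k == e)))%N.
Proof.
have C := card_quartic_residues lK l_odd alpha_l sqr_im lE.
rewrite (card_pairs (fun c s => admissible l alpha c &&
  quartic_test (e (+) ((l %% 4 == 3)%N && s)) c)).
have k0 : (0 < k)%N by case: lE (prime_gt1 l_prime); clear; lia.
case: (l %% 4 == 3)%N => /=; rewrite ?addbF.
  have := C true; have := C false; move: k0; clear C.
  case: e => /=; rewrite /quartic_test;
  move: #|[set c : 'I_l | _ & _ == (-1) ^+ true * _]|
        #|[set c : 'I_l | _ & _ == (-1) ^+ false * _]|; case: (odd k); clear; lia.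
have := C e; rewrite /quartic_test; move: #|_|; clear; lia.
Qed.

(** The denominator counts all primes alpha^2 + x^2, including possibly 2 and l,
    which lie in no admissible class; they make up the bounded error term of
    ratio_cvg. *)
Lemma has_dens_classes (R : realType) (HL : HardyLittlewood R) (e : bool) :
  has_dens l%:Z ((-1) ^+ e * alpha)
   (#|[set i : 'I_l * bool | admissible l alpha i.1 & class_good e i]|%:R /
    #|adm|%:R : R).
Proof.
have r2 : ((-1) ^+ e * alpha) ^+ 2 = alpha ^+ 2.
  by rewrite exprMn -exprM mulnC exprM sqrrN !expr1n mul1r.
rewrite /has_dens.
set S := [set i | _ & _]; set r := (-1) ^+ e * alpha in r2 *.
have H := @ratio_cvg R _ (class_count alpha) (class_delta R l alpha) adm S
  (fun N => count (predC (unramified l)) (Q r N)).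
have -> : dens_seq R l%:Z r = fun N => (\sum_(i in S) class_count alpha i N.+1)%N%:R /
   (\sum_(i in adm) class_count alpha i N.+1 +
     count (predC (unramified l)) (Q r N))%N%:R.
  apply/funext => N; apply: dens_seq_classes => // i p adm_i ip up.
  exact: ap_class.
apply: H.
- exact: class_delta_neq0.
- by apply/fintype.subsetP => i; rewrite !inE => /andP[].
- have := card_adm_classes.
  have : (0 < k)%N by case: lE (prime_gt1 l_prime); clear; lia.
  by clear; lia.
- by move=> N; apply: count_ramified.
- by move=> i; rewrite inE => adm_i; apply: class_equiv.
Qed.

End QuarticDensity.

(* The hypothesis that l does not divide alpha is implicit in the source: when
   l | alpha the asserted values are wrong (for l = alpha = 5 one finds
   a_p(E_5) = -10 for every p = 25 + x^2 > 5). *)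
Theorem theorem3p6 (R : realType) (HL : HardyLittlewood R)
    (alpha : int) (alpha_mod4 : (alpha = 1 %[mod 4])%Z)
    (l : nat) (l_prime : prime l) (l_odd : odd l)
    (l_ndvd_alpha : ~~ (l%:Z %| alpha)%Z) :
  [/\ (l = 1 %[mod 8])%N ->
        has_dens l%:Z alpha ((l%:R - 5) / (4 * (l%:R - 2)) : R) /\
        has_dens l%:Z (- alpha) ((l%:R - 1) / (4 * (l%:R - 2)) : R),
      (l = 5 %[mod 8])%N ->
        has_dens l%:Z alpha ((l%:R - 1) / (4 * (l%:R - 2)) : R) /\
        has_dens l%:Z (- alpha) ((l%:R - 5) / (4 * (l%:R - 2)) : R)
    & (l = 3 %[mod 4])%N ->
        has_dens l%:Z alpha ((l%:R - 1) / (4 * l%:R) : R) /\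
        has_dens l%:Z (- alpha) ((l%:R - 1) / (4 * l%:R) : R)].
Proof.
have [K lK] := closed_field_pchar l_prime.
have [im sqr_im] := GRing.imaginary_exists K.
(* One k for both cases: l = 4k + 1 or l = 4k - 1. *)
pose k := (l.+1 %/ 4)%N.
have lE : l = (4 * k).+1 \/ l.+1 = (4 * k)%N.
  by move: l_odd; rewrite /k; clear; lia.
have k0 : (0 < k)%N by move: lE (prime_gt1 l_prime); clear; lia.
have D e := has_dens_classes l_prime lE alpha_mod4 l_ndvd_alpha lK sqr_im HL e.
have A := card_adm_classes l_prime lE l_ndvd_alpha lK sqr_im.
have C e := card_good_classes l_prime lE l_ndvd_alpha lK sqr_im e.
move: (D false) (D true); rewrite {D} !C expr0 mul1r expr1 mulN1r.
set a := #|_| in A *; have k1 : 1 <= k%:R :> R by rewrite ler1n.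
have aE : a%:R = 8 * k%:R - 2 :> R.
  by rewrite -[8]/(8%:R) -natrM -A natrD addrK.
rewrite aE => Dp Dm.
have value (r : int) (n : nat) (v : R) :
    has_dens l%:Z r (n%:R / (8 * k%:R - 2) : R) ->
    n%:R / (8 * k%:R - 2) = v -> has_dens l%:Z r v by move=> H <-.
have km1 : (k - 1)%N%:R = k%:R - 1 :> R by rewrite natrB.
have km2 : (2 * k - 1)%N%:R = 2 * k%:R - 1 :> R.
  by rewrite natrB ?natrM // muln_gt0.
split=> lmod.
- have k_even : odd k = false by rewrite /k; move: lmod; clear; lia.
  have lR : l%:R = 4 * k%:R + 1 :> R.
    by rewrite -natrM natr1; congr _%:R; rewrite /k; move: lmod; clear; lia.
  have l3 : (l %% 4 == 3)%N = false by move: lmod; clear; lia.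
  rewrite l3 k_even /= in Dp Dm; split.
    apply: (value _ _ _ Dp); rewrite natrM km1 lR.
    by field; apply/andP; split; rewrite gt_eqF //; lra.
  apply: (value _ _ _ Dm); rewrite subn0 natrM lR.
  by field; apply/andP; split; rewrite gt_eqF //; lra.
- have k_odd : odd k by rewrite /k; move: lmod; clear; lia.
  have lR : l%:R = 4 * k%:R + 1 :> R.
    by rewrite -natrM natr1; congr _%:R; rewrite /k; move: lmod; clear; lia.
  have l3 : (l %% 4 == 3)%N = false by move: lmod; clear; lia.
  rewrite l3 k_odd /= in Dp Dm; split.
    apply: (value _ _ _ Dp); rewrite subn0 natrM lR.
    by field; apply/andP; split; rewrite gt_eqF //; lra.
  apply: (value _ _ _ Dm); rewrite natrM km1 lR.
  by field; apply/andP; split; rewrite gt_eqF //; lra.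
- have lR : l%:R = 4 * k%:R - 1 :> R.
    have -> : 4 * k%:R = l.+1%:R :> R.
      by rewrite -natrM; congr _%:R; rewrite /k; move: lmod; clear; lia.
    by rewrite -natr1 addrK.
  have l3 : (l %% 4 == 3)%N by move: lmod; clear; lia.
  rewrite l3 in Dp Dm; split.
    apply: (value _ _ _ Dp); rewrite km2 lR.
    by field; apply/andP; split; rewrite gt_eqF //; lra.
  apply: (value _ _ _ Dm); rewrite km2 lR.
  by field; apply/andP; split; rewrite gt_eqF //; lra.
Qed.
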